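(* Let $M\subset\mathbb{C}$ be a set of multipliers such that $\Omega=\mathbb{C}\setminus M^*$ is a simply connected domain containing $0$, $\Omega\ne\mathbb{C}$. Suppose that the set $\langle a\rangle=\{a_1,a_2,\dots,a_n\}$ successfully $\langle a\rangle$-stabilizes any fixed point with multiplier $\mu\in M$. Then $$n\ge\frac{\sqrt{\mu_M}}{3\sqrt3}.$$
   Context: $\Delta=\{z\in\mathbb{C}:|z|<1\}$. $M^*=\{1/z:z\in M\}$, with the convention $1/0=\infty$. $\mu_M=\sup\{|z|:z\in M\}$. An averaging set $\langle a\rangle=\{a_1,\dots,a_n\}$ is a finite sequence of complex numbers with $a_1+\dots+a_n=1$ and $a_1\ne0$. Put $p(z)=a_n+a_{n-1}z+\dots+a_1z^{n-1}$. By definition, $\langle a\rangle$ stabilizes a fixed point with multiplier $\mu$ if and only if all roots of $z^n-\mu p(z)$ lie in $\Delta$. (So the hypothesis says that for every $\mu\in M$ all roots of $z^n-\mu p(z)$ lie in $\Delta$.) *)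

(* Defs.v *)
From HB Require Import structures.
From mathcomp Require Import all_boot all_order all_algebra.
From mathcomp Require Import all_classical all_reals all_analysis.
From mathcomp Require Export complex.

Set Implicit Arguments.
Unset Strict Implicit.
Unset Printing Implicit Defensive.

Import Order.TTheory GRing.Theory Num.Theory.
Import numFieldNormedType.Exports.

Local Open Scope classical_set_scope.
Local Open Scope ring_scope.
Local Open Scope complex_scope.

(* [R[i]^o] is convertible to [R[i]]; it carries the norm topology of the
   complex plane. *)

Definition is_domain (T : topologicalType) (D : set T) : Prop :=
  [/\ D !=set0, open D & connected D].

Definition is_path_in (R : realType) (T : topologicalType) (D : set T)
    (g : R -> T) : Prop :=
  {within `[0, 1], continuous g} /\ g @` `[0, 1] `<=` D.

Definition is_path_connected (R : realType) (T : topologicalType)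
    (D : set T) : Prop :=
  forall x y, D x -> D y ->
    exists g : R -> T, [/\ is_path_in D g, g 0 = x & g 1 = y].

(* The first coordinate of [H] is the homotopy parameter; the base point of the
   loop stays fixed along the homotopy. *)
Definition is_null_homotopic_in (R : realType) (T : topologicalType)
    (D : set T) (g : R -> T) : Prop :=
  exists H : R * R -> T,
    [/\ {within `[0, 1] `*` `[0, 1], continuous H},
        H @` (`[0, 1] `*` `[0, 1]) `<=` D,
        {in `[0, 1], forall t, H (0, t) = g t /\ H (1, t) = g 0} &
        {in `[0, 1], forall s, H (s, 0) = g 0 /\ H (s, 1) = g 0}].

Definition is_simply_connected (R : realType) (T : topologicalType)
    (D : set T) : Prop :=
  is_path_connected R D /\
  (forall g : R -> T, is_path_in D g -> g 0 = g 1 ->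
     is_null_homotopic_in D g).

Definition is_averaging_set (R : realType) (a : seq R[i]) : Prop :=
  \sum_(c <- a) c = 1 /\ a`_0 != 0.

(* Coefficients are listed by increasing degree, so that for
   [a = [:: a_1; ...; a_n]] this is [a_n + a_(n-1) X + ... + a_1 X^(n-1)]. *)
Definition averaging_poly (R : realType) (a : seq R[i]) : {poly R[i]} :=
  Poly (rev a).

Definition unit_disk (R : realType) : set R[i] := [set z | `|z| < 1].

Definition stabilizes (R : realType) (a : seq R[i]) (mu : R[i]) : Prop :=
  forall z, root ('X^(size a) - mu *: averaging_poly a) z -> unit_disk z.

(* Reciprocal with values in the Riemann sphere; [None] is the point at
   infinity. *)
Definition sphere_inv (R : realType) (z : R[i]) :
    one_point_compactification R[i]^o :=
  if z == 0 then None else Some z^-1.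

Definition reciprocals (R : realType) (M : set R[i]) :
    set (one_point_compactification R[i]^o) :=
  [set sphere_inv z | z in M].

Definition reciprocal_complement (R : realType) (M : set R[i]) : set R[i]^o :=
  [set w | ~ reciprocals M (Some w)].

(* The supremum is taken in the extended reals, hence is also meaningful for
   unbounded [M]. *)
Definition sup_norm (R : realType) (M : set R[i]) : \bar R :=
  ereal_sup [set (Normc.normc z)%:E | z in M].

(* Main.v *)
(* Put [F w = a_1 w + ... + a_n w^n].  Stabilization says that [F] maps the closed
   unit disk into [Omega]; moreover [F 0 = 0] and [F 1 = 1].  Fix [mu] in [M],
   [mu <> 0], so that [p = 1 - mu F] has no zero in the disk, and let [h] be the
   square root of [p] with [h 0 = 1].  As [Omega] is simply connected and omits
   [1 / mu], one has [h z + h w <> 0] for all [z], [w] in the disk ([h] is a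
   Gelfer function).  Instead of a Riemann map, the Koebe-type estimate
   [|p' a| (1 - |a|^2) <= 4 |p a|] comes from potential theory: charges [1] at
   the points [h (T (z zeta_i))] and [-1] at their opposites, where [T] is the
   disk automorphism taking [0] to [a] and the [zeta_i] are the [N]-th roots of
   unity, have nonnegative logarithmic energy, and the maximum principle in [z]
   compares this energy with its value at [z = 0]; then [N] tends to infinity.
   Integrating along radii, [|p z| <= ((1 + r) / (1 - r))^2] for [|z| = r].
   The Bernstein-Walsh inequality [r^n |mu F 1| <= max_(|z| = r) |mu F z|]
   with [r = n / (n + 2)] gives [|mu| <= 27 n^2]. *)

Require Import Defs.
From mathcomp Require Import all_boot all_order all_algebra.
From mathcomp Require Import all_classical all_reals all_analysis.
From mathcomp Require Import ring lra.
Set Implicit Arguments.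
Unset Strict Implicit.
Unset Printing Implicit Defensive.
Import Order.TTheory GRing.Theory Num.Theory.
Import numFieldNormedType.Exports.
Local Open Scope classical_set_scope.
Local Open Scope ring_scope.
Local Open Scope complex_scope.

Local Notation nc := Normc.normc.
Local Notation Re := complex.Re.
Local Notation Im := complex.Im.
Local Arguments Normc.normc : simpl never.

(** * The modulus of complex numbers as a real number *)

Section Modulus.
Context {R : realType}.
Local Notation C := R[i].
Implicit Types (x y z w : C) (r s : R).

Lemma nc_ge0 z : 0 <= nc z.
Proof. by case: z => a b; exact: sqrtr_ge0. Qed.

Lemma normrcE z : `|z| = (nc z)%:C.
Proof. by case: z. Qed.

Lemma nc0 : nc (0 : C) = 0. Proof. exact: Normc.normc0. Qed.
Lemma nc1 : nc (1 : C) = 1. Proof. exact: Normc.normc1. Qed.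
Lemma ncM x y : nc (x * y) = nc x * nc y. Proof. exact: Normc.normcM. Qed.
Lemma ncV x : nc x^-1 = (nc x)^-1. Proof. exact: Normc.normcV. Qed.
Lemma ncN x : nc (- x) = nc x. Proof. exact: (@normcN R x). Qed.
Lemma ncD x y : nc (x + y) <= nc x + nc y.
Proof. exact: (@le_normcD R x y). Qed.

Lemma ncB x y : nc (x - y) <= nc x + nc y.
Proof. by rewrite -(ncN y) ncD. Qed.

Lemma ncBC x y : nc (x - y) = nc (y - x).
Proof. by rewrite -ncN opprB. Qed.

Lemma nc_ge_sub x y : nc x - nc y <= nc (x + y).
Proof. by have := ncB (x + y) y; rewrite addrK; lra. Qed.

Lemma nc_eq0 z : (nc z == 0) = (z == 0).
Proof. by apply/eqP/eqP => [/Normc.eq0_normc//|->]; exact: nc0. Qed.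

Lemma nc_gt0 z : (0 < nc z) = (z != 0).
Proof. by rewrite lt_def nc_ge0 nc_eq0 andbT. Qed.

Lemma ncX z k : nc (z ^+ k) = nc z ^+ k.
Proof. by elim: k => [|k IH]; rewrite ?expr0 ?nc1// !exprS ncM IH. Qed.

Lemma nc_prod (I : Type) (s : seq I) (P : pred I) (F : I -> C) :
  nc (\prod_(i <- s | P i) F i) = \prod_(i <- s | P i) nc (F i).
Proof. by apply: (big_morph _ ncM nc1). Qed.

Lemma nc_real r : nc r%:C = `|r|.
Proof. by rewrite /Normc.normc /= expr0n addr0 sqrtr_sqr. Qed.

Lemma nc_sqrE z : nc z ^+ 2 = Re z ^+ 2 + Im z ^+ 2.
Proof. by case: z => a b /=; rewrite sqr_sqrtr// addr_ge0 ?sqr_ge0. Qed.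

Lemma Re_le_nc z : `|Re z| <= nc z.
Proof.
rewrite -(@ler_pXn2r _ 2) ?nnegrE ?nc_ge0// nc_sqrE real_normK ?num_real//.
by rewrite lerDl sqr_ge0.
Qed.

Lemma Im_le_nc z : `|Im z| <= nc z.
Proof.
rewrite -(@ler_pXn2r _ 2) ?nnegrE ?nc_ge0// nc_sqrE real_normK ?num_real//.
by rewrite lerDr sqr_ge0.
Qed.

Lemma nc_le_ReIm z : nc z <= `|Re z| + `|Im z|.
Proof.
rewrite -(@ler_pXn2r _ 2) ?nnegrE ?nc_ge0 ?addr_ge0// nc_sqrE.
rewrite -(real_normK (num_real (Re z))) -(real_normK (num_real (Im z))).
by have := normr_ge0 (Re z); have := normr_ge0 (Im z); nra.
Qed.

Lemma ncJ z : nc z^* = nc z.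
Proof. by case: z => a b; rewrite /Normc.normc /= sqrrN. Qed.

End Modulus.

(** * Functions with a second-order expansion *)

Section SecondOrder.
Context {R : realType}.
Local Notation C := R[i].
Implicit Types (f g e : C -> C) (z w : C).

Definition bounded_near0 e : Prop :=
  exists M d : R, 0 < d /\ forall w, nc w < d -> nc (e w) <= M.

(** Stands in for holomorphy: a complex Taylor expansion of order two with a bounded cubic
    remainder. The class is closed under algebraic operations, composition and suitable square
    roots, and a cubic error is small enough for the four-point average behind the maximum
    principle. *)
Definition second_order f z : Prop :=
  exists b c e, bounded_near0 e /\
    exists2 d : R, 0 < d & forall w, nc w < d ->
      f (z + w) = f z + b * w + c * w ^+ 2 + w ^+ 3 * e w.

Lemma bounded_near0_cst c : bounded_near0 (fun=> c).
Proof. by exists (nc c), 1; split. Qed.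

Lemma bounded_near0_id : bounded_near0 id.
Proof. by exists 1, 1; split => // w /ltW. Qed.

Lemma bounded_near0D e1 e2 : bounded_near0 e1 -> bounded_near0 e2 ->
  bounded_near0 (fun w => e1 w + e2 w).
Proof.
move=> [M1 [d1 [d1_gt0 h1]]] [M2 [d2 [d2_gt0 h2]]].
exists (M1 + M2), (Num.min d1 d2); split; first by rewrite lt_min d1_gt0.
move=> w; rewrite lt_min => /andP[/h1 l1 /h2 l2].
by apply: le_trans (ncD _ _) _; exact: lerD.
Qed.

Lemma bounded_near0M e1 e2 : bounded_near0 e1 -> bounded_near0 e2 ->
  bounded_near0 (fun w => e1 w * e2 w).
Proof.
move=> [M1 [d1 [d1_gt0 h1]]] [M2 [d2 [d2_gt0 h2]]].
exists (M1 * M2), (Num.min d1 d2); split; first by rewrite lt_min d1_gt0.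
move=> w; rewrite lt_min => /andP[/h1 l1 /h2 l2].
by rewrite ncM ler_pM ?nc_ge0.
Qed.

Lemma bounded_near0_eq (d : R) e1 e2 : 0 < d ->
  (forall w, nc w < d -> e1 w = e2 w) -> bounded_near0 e1 -> bounded_near0 e2.
Proof.
move=> d_gt0 h12 [M1 [d1 [d1_gt0 h1]]].
exists M1, (Num.min d d1); split; first by rewrite lt_min d_gt0.
by move=> w; rewrite lt_min => /andP[/h12 <- /h1].
Qed.

Lemma bounded_near0V e (m d : R) : 0 < m -> 0 < d ->
  (forall w, nc w < d -> m <= nc (e w)) -> bounded_near0 (fun w => (e w)^-1).
Proof.
move=> m_gt0 d_gt0 h; exists m^-1, d; split => // w /h mle.
by rewrite ncV lef_pV2 ?posrE// (lt_le_trans m_gt0).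
Qed.

Lemma bounded_near0_comp e k :
  bounded_near0 e -> bounded_near0 k -> bounded_near0 (fun w => e (w * k w)).
Proof.
move=> [M1 [d1 [d1_gt0 h1]]] [M2 [d2 [d2_gt0 h2]]].
have M2_ge0 : 0 <= M2 by apply: le_trans (h2 0 _); rewrite ?nc_ge0 ?nc0.
exists M1, (Num.min d2 (d1 / (M2 + 1))); split.
  by rewrite lt_min d2_gt0 divr_gt0// ltr_wpDl.
move=> w; rewrite lt_min => /andP[/h2 l2].
rewrite ltr_pdivlMr ?ltr_wpDl// => l1; apply: h1; rewrite ncM.
apply: le_lt_trans l1; apply: ler_wpM2l; [exact: nc_ge0 | lra].
Qed.

Lemma second_order_bounded f z : second_order f z ->
  exists k, bounded_near0 k /\
    exists2 d : R, 0 < d & forall w, nc w < d -> f (z + w) = f z + w * k w.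
Proof.
move=> [b [c [e [be [d d_gt0 h]]]]].
exists (fun w => b + (c * w + (w * w) * e w)); split; last first.
  by exists d => // w /h ->; ring.
by do ![exact: bounded_near0_cst | exact: bounded_near0_id | exact: be
       | apply: bounded_near0D | apply: bounded_near0M].
Qed.

Lemma second_order_continuous f z (eps : R) : second_order f z -> 0 < eps ->
  exists2 d : R, 0 < d & forall w, nc w < d -> nc (f (z + w) - f z) < eps.
Proof.
move=> /second_order_bounded[k [[M [d1 [d1_gt0 hk]]] [d d_gt0 h]]] eps_gt0.
have M_ge0 : 0 <= M by apply: le_trans (hk 0 _); rewrite ?nc_ge0 ?nc0.
exists (Num.min (Num.min d d1) (eps / (M + 1))).
  by rewrite !lt_min d_gt0 d1_gt0 divr_gt0// ltr_wpDl.
move=> w; rewrite !lt_min => /andP[/andP[/h -> /hk kM]].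
rewrite ltr_pdivlMr ?ltr_wpDl// => lt.
rewrite addrC addKr ncM; apply: le_lt_trans lt.
by apply: ler_wpM2l; [exact: nc_ge0 | lra].
Qed.

Lemma second_order_away0 f z : second_order f z -> f z != 0 ->
  exists2 d : R, 0 < d & forall w, nc w < d -> nc (f z) / 2 <= nc (f (z + w)).
Proof.
rewrite -nc_gt0 => hf fz0.
have [d d_gt0 h] := second_order_continuous hf (divr_gt0 fz0 (ltr0Sn R 1)).
exists d => // w /h; have := nc_ge_sub (f z) (f (z + w) - f z).
by rewrite subrKC; lra.
Qed.

Lemma second_order_eq f g z (d : R) : 0 < d ->
  (forall w, nc w < d -> f (z + w) = g (z + w)) ->
  second_order f z -> second_order g z.
Proof.
move=> d_gt0 fg [b [c [e [be [d1 d1_gt0 h]]]]].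
exists b, c, e; split => //; exists (Num.min d d1); first by rewrite lt_min d_gt0.
move=> w; rewrite lt_min => /andP[/fg <- /h ->].
by have := fg 0; rewrite addr0 nc0 => ->.
Qed.

Lemma second_order_cst c z : second_order (fun=> c) z.
Proof.
exists 0, 0, (fun=> 0); split; first exact: bounded_near0_cst.
by exists 1 => // w _; ring.
Qed.

Lemma second_order_id z : second_order id z.
Proof.
exists 1, 0, (fun=> 0); split; first exact: bounded_near0_cst.
by exists 1 => // w _; ring.
Qed.

Lemma second_orderD f g z : second_order f z -> second_order g z ->
  second_order (fun w => f w + g w) z.
Proof.
move=> [b [c [e [be [d d_gt0 h]]]]] [b' [c' [e' [be' [d' d'_gt0 h']]]]].
exists (b + b'), (c + c'), (fun w => e w + e' w); split.
  exact: bounded_near0D.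
exists (Num.min d d'); first by rewrite lt_min d_gt0.
by move=> w; rewrite lt_min => /andP[/h -> /h' ->]; ring.
Qed.

Lemma second_orderM f g z : second_order f z -> second_order g z ->
  second_order (fun w => f w * g w) z.
Proof.
move=> [b [c [e [be [d d_gt0 h]]]]] [b' [c' [e' [be' [d' d'_gt0 h']]]]].
exists (f z * b' + b * g z), (f z * c' + b * b' + c * g z).
exists (fun w => (b * c' + c * b') + (c * c') * w +
   (f z + b * w + c * (w * w)) * e' w + (g z + b' * w + c' * (w * w)) * e w
   + ((w * w) * w) * (e w * e' w)); split.
  by do ![exact: bounded_near0_cst | exact: bounded_near0_id | exact: be
         | exact: be' | apply: bounded_near0D | apply: bounded_near0M].
exists (Num.min d d'); first by rewrite lt_min d_gt0.
by move=> w; rewrite lt_min => /andP[/h -> /h' ->]; ring.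
Qed.

Lemma second_orderN f z : second_order f z -> second_order (fun w => - f w) z.
Proof.
move=> hf; apply: (@second_order_eq (fun w => -1 * f w) _ _ 1) => //.
  by move=> w _; ring.
by apply: second_orderM => //; exact: second_order_cst.
Qed.

Lemma second_orderX f z k :
  second_order f z -> second_order (fun w => f w ^+ k) z.
Proof.
move=> hf; elim: k => [|k IH].
  exact: (second_order_cst 1).
apply: (@second_order_eq (fun w => f w * f w ^+ k) _ _ 1) => //.
  by move=> w _; rewrite exprS.
exact: second_orderM.
Qed.

Lemma second_order_prod (I : Type) (s : seq I) (P : pred I) (F : I -> C -> C) z :
  (forall i, P i -> second_order (F i) z) ->
  second_order (fun w => \prod_(i <- s | P i) F i w) z.
Proof.
move=> hF; elim: s => [|i s IH].
  by apply: (@second_order_eq (fun=> 1) _ _ 1 _ _ (second_order_cst 1 z)) => // w _;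
    rewrite big_nil.
case Pi: (P i); last first.
  by apply: (second_order_eq ltr01 _ IH) => w _; rewrite big_cons Pi.
by apply: (second_order_eq ltr01 _ (second_orderM (hF _ Pi) IH)) => w _;
  rewrite big_cons Pi.
Qed.

Lemma second_order_sum (I : Type) (s : seq I) (P : pred I) (F : I -> C -> C) z :
  (forall i, P i -> second_order (F i) z) ->
  second_order (fun w => \sum_(i <- s | P i) F i w) z.
Proof.
move=> hF; elim: s => [|i s IH].
  by apply: (@second_order_eq (fun=> 0) _ _ 1 _ _ (second_order_cst 0 z)) => // w _;
    rewrite big_nil.
case Pi: (P i); last first.
  by apply: (second_order_eq ltr01 _ IH) => w _; rewrite big_cons Pi.
by apply: (second_order_eq ltr01 _ (second_orderD (hF _ Pi) IH)) => w _;
  rewrite big_cons Pi.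
Qed.

Lemma second_orderV f z : second_order f z -> f z != 0 ->
  second_order (fun w => (f w)^-1) z.
Proof.
move=> hf fz0; have [d0 d0_gt0 h0] := second_order_away0 hf fz0.
have fz_gt0 : 0 < nc (f z) / 2 by rewrite divr_gt0 ?nc_gt0.
case: hf => [b [c [e [be [d d_gt0 h]]]]].
pose g := f z.
pose b' := - b / g ^+ 2.
pose c' := (b ^+ 2 - g * c) / g ^+ 3.
(* [b'] and [c'] cancel the terms of degree 1 and 2 in the product of [f (z + w)] with
   [g^-1 + b' w + c' w^2]. That product is then [1 - w^3 e1 w], and dividing by [f (z + w)] gives
   the remainder. *)
pose e1 w := - ((b * c' + c * b') + c * c' * w + (g^-1 + b' * w + c' * (w * w)) * e w).
exists b', c', (fun w => e1 w * (f (z + w))^-1); split.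
  apply: bounded_near0M; last exact: (bounded_near0V fz_gt0 d0_gt0 h0).
  apply: (@bounded_near0_eq 1 (fun w => -1 * ((b * c' + c * b') + c * c' * w
      + (g^-1 + b' * w + c' * (w * w)) * e w))) => //.
    by move=> w _; rewrite /e1; ring.
  by do ![exact: bounded_near0_cst | exact: bounded_near0_id | exact: be
         | apply: bounded_near0D | apply: bounded_near0M].
exists (Num.min d d0); first by rewrite lt_min d_gt0.
move=> w; rewrite lt_min => /andP[hd /h0 hfw].
have fw0 : f (z + w) != 0 by rewrite -nc_gt0 (lt_le_trans fz_gt0).
apply: (mulIf fw0); rewrite mulVf// mulrDl -(mulrA (w ^+ 3)) mulfVK//.
by rewrite (h _ hd) /e1 /c' /b' -/g; field.
Qed.

Lemma second_order_comp f g z : second_order g z -> second_order f (g z) ->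
  second_order (fun w => f (g w)) z.
Proof.
move=> hg [b [c [e [be [d d_gt0 h]]]]].
have [k [bk [d1 d1_gt0 h1]]] := second_order_bounded hg.
case: (hg) => [b' [c' [e' [be' [d' d'_gt0 h']]]]].
have [d2 d2_gt0 h2] := second_order_continuous hg d_gt0.
exists (b * b'), (b * c' + c * b' ^+ 2).
exists (fun w => b * e' w + c * ((b' + b') * c' + w * (c' * c')
   + (b' + b' + w * (c' + c')) * (w * e' w) + (w * w) * w * (e' w * e' w))
   + k w * k w * k w * e (w * k w)); split.
  by do ![exact: bounded_near0_cst | exact: bounded_near0_id | exact: be'
         | exact: bk | apply: bounded_near0_comp
         | apply: bounded_near0D | apply: bounded_near0M].
exists (Num.min (Num.min d1 d2) d'); first by rewrite !lt_min d1_gt0 d2_gt0.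
move=> w; rewrite !lt_min => /andP[/andP[hw1 hw2] hw'].
have := h2 w hw2; rewrite (h1 _ hw1) addrAC subrr add0r => hwk.
rewrite (h _ hwk).
have E : w * k w = b' * w + c' * w ^+ 2 + w ^+ 3 * e' w.
  by apply: (addrI (g z)); rewrite -h1// h'//; ring.
suff -> : (w * k w) ^+ 2 = (b' * w + c' * w ^+ 2 + w ^+ 3 * e' w) ^+ 2.
  by rewrite {1}E; ring.
by rewrite E.
Qed.

(** No continuity of [s] is assumed: the half-plane condition selects the branch. With [p] the
    Taylor candidate, [s - p = (f - p^2) / (s + p)]; the condition gives [|s + g| >= |g|], so that
    [s + p] stays away from [0] near [z]. *)
Lemma second_order_root f s z (d1 : R) : 0 < d1 ->
  (forall w, nc w < d1 -> s (z + w) ^+ 2 = f (z + w)) ->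
  second_order f z -> s z != 0 ->
  (forall w, nc w < d1 -> 0 <= Re (s (z + w) / s z)) ->
  second_order s z.
Proof.
move=> d1_gt0 sf hf sz0 Re_ge0.
case: (hf) => [b [c [e [be [d d_gt0 h]]]]].
pose g := s z.
have g2 : g ^+ 2 = f z by have := sf 0; rewrite addr0 nc0; exact.
have two0 : (2 : C) != 0 by rewrite pnatr_eq0.
pose b' := b / (2 * g).
pose c' := (c - b' ^+ 2) / (2 * g).
pose p w := g + b' * w + c' * w ^+ 2.
have hp : second_order p 0.
  apply: second_orderD; first apply: second_orderD; first exact: second_order_cst.
    by apply: second_orderM; [exact: second_order_cst | exact: second_order_id].
  by apply: second_orderM; [exact: second_order_cst |
    apply: second_orderX; exact: second_order_id].
have g_gt0 : 0 < nc g by rewrite nc_gt0.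
have [d2 d2_gt0 h2] := second_order_continuous hp (divr_gt0 g_gt0 (ltr0Sn R 1)).
have hden w : nc w < Num.min d1 d2 -> nc g / 2 <= nc (s (z + w) + p w).
  rewrite lt_min => /andP[/Re_ge0 hRe /h2].
  have -> : p 0 = g by rewrite /p; ring.
  rewrite add0r => hpg.
  have : nc g <= nc (s (z + w) + g).
    have -> : s (z + w) + g = (s (z + w) / g + 1) * g.
      by rewrite mulrDl mul1r mulfVK.
    rewrite ncM ler_peMl ?nc_ge0//; apply: le_trans (Re_le_nc _).
    by apply: le_trans (ler_norm _); rewrite raddfD /=; rewrite -/g in hRe; lra.
  have := nc_ge_sub (s (z + w) + g) (p w - g).
  have -> : s (z + w) + g + (p w - g) = s (z + w) + p w by ring.
  lra.
exists b', c', (fun w => (- ((b' + b') * c' + (c' * c') * w) + e w) * (s (z + w) + p w)^-1).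
split.
  apply: bounded_near0M; last first.
    apply: (bounded_near0V _ _ hden); first by rewrite divr_gt0.
    by rewrite lt_min d1_gt0.
  apply: bounded_near0D => //.
  apply: (@bounded_near0_eq 1 (fun w => -1 * ((b' + b') * c' + (c' * c') * w))) => //.
    by move=> w _; ring.
  by do ![exact: bounded_near0_cst | exact: bounded_near0_id 
         | apply: bounded_near0D | apply: bounded_near0M].
exists (Num.min (Num.min d1 d2) d).
  by rewrite !lt_min d1_gt0 d2_gt0.
move=> w; rewrite lt_min => /andP[hw hwd].
have den0 : s (z + w) + p w != 0.
  by rewrite -nc_gt0; apply: lt_le_trans (hden _ hw); rewrite divr_gt0.
apply: (addIr (- p w)); apply: (mulIf den0).
rewrite -subr_sqr sf; last by move: hw; rewrite lt_min => /andP[].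
rewrite (h _ hwd) -g2 -/g.
have -> : g + b' * w + c' * w ^+ 2 + w ^+ 3 *
   ((- ((b' + b') * c' + c' * c' * w) + e w) / (s (z + w) + p w)) - p w =
   w ^+ 3 * ((- ((b' + b') * c' + c' * c' * w) + e w)) / (s (z + w) + p w).
  by rewrite /p; ring.
rewrite mulfVK// /p.
have -> : b = 2 * g * b' by rewrite /b'; field.
have -> : c = 2 * g * c' + b' ^+ 2 by rewrite /c'; field.
by ring.
Qed.

End SecondOrder.

(** * The maximum principle *)

Section Compactness.
Context {R : realType}.
Local Notation C := R[i].

(** Compactness arguments take place in [R * R], where squares are products of segments, and are
    transported along this map. *)
Definition cplx_of (p : R * R) : C := p.1 +i* p.2.
Arguments cplx_of : simpl never.

Lemma near_cplx_of (p : R * R) (Q : C -> Prop) (d : R) : 0 < d ->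
  (forall w, nc w < d -> Q (cplx_of p + w)) -> \forall q \near p, Q (cplx_of q).
Proof.
move=> d_gt0 hQ; apply/nbhs_ballP; exists (d / 2) => /=; first by rewrite divr_gt0.
move=> q [b1 b2].
have -> : cplx_of q = cplx_of p + (cplx_of q - cplx_of p) by rewrite subrKC.
apply: hQ; apply: le_lt_trans (nc_le_ReIm _) _.
move: b1 b2; rewrite /ball /= => b1 b2.
by rewrite (distrC q.1) (distrC q.2); lra.
Qed.

Lemma compact_disk : compact [set p : R * R | nc (cplx_of p) <= 1].
Proof.
have -> : [set p : R * R | nc (cplx_of p) <= 1] =
   (`[-1, 1] `*` `[-1, 1]) `&` [set p : R * R | nc (cplx_of p) <= 1].
  apply/seteqP; split => [p hp|p []//]; split => //.
  have := le_trans (Re_le_nc _) hp; have := le_trans (Im_le_nc _) hp.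
  by rewrite /= !ler_norml => h1 h2; split; rewrite /= in_itv.
apply: compact_closedI; first by apply: compact_setX; exact: segment_compact.
rewrite -[X in closed X]setCK; apply: open_closedC.
rewrite openE => p /= /negP; rewrite -ltNge => hp.
apply: (@near_cplx_of p (fun z => ~ (nc z <= 1)) (nc (cplx_of p) - 1)).
  by rewrite subr_gt0.
move=> w hw; apply/negP; rewrite -ltNge.
by have := nc_ge_sub (cplx_of p) w; lra.
Qed.

Lemma cplx_of_ReIm (z : C) : cplx_of (Re z, Im z) = z.
Proof. by case: z. Qed.

Lemma disk_attains_max (u : C -> R) :
  (forall z, nc z <= 1 -> forall eps : R, 0 < eps ->
     exists2 d : R, 0 < d & forall w, nc w < d -> `|u (z + w) - u z| < eps) ->
  exists2 z0, nc z0 <= 1 & forall z, nc z <= 1 -> u z <= u z0.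
Proof.
move=> hu.
have A0 : [set p : R * R | nc (cplx_of p) <= 1] !=set0.
  by exists (0, 0); rewrite /= /cplx_of [X in nc X](_ : _ = 0) ?nc0.
have [|p /set_mem hp pmax] :=
  @compact_EVT_max _ _ (fun p => u (cplx_of p)) _ A0 compact_disk.
  apply/subspace_continuousP => p hp.
  apply: cvg_within_filter; apply/cvgrPdist_lt => eps eps_gt0.
  have [d d_gt0 hd] := hu _ hp _ eps_gt0.
  apply: (@near_cplx_of p (fun z => `|u (cplx_of p) - u z| < eps) d) => // w.
  by move=> /hd; rewrite distrC.
exists (cplx_of p) => // z hz; have := pmax (Re z, Im z).
by rewrite cplx_of_ReIm; apply; apply/mem_set; rewrite /= cplx_of_ReIm.
Qed.

Lemma disk2_bounded_away0 (g : C -> C -> R) :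
  (forall z w, nc z <= 1 -> nc w <= 1 -> exists2 m : R, 0 < m &
     exists2 d : R, 0 < d & forall z' w', nc z' < d -> nc w' < d ->
        m <= g (z + z') (w + w')) ->
  exists2 m : R, 0 < m & forall z w, nc z <= 1 -> nc w <= 1 -> m <= g z w.
Proof.
move=> hg.
have /compact_near_coveringP cK := compact_setX (@compact_disk) (@compact_disk).
(* The parameter [m] runs along the filter of positive reals tending to [0]. A local lower bound
   remains valid when [m] decreases, so the near-covering form of compactness yields a uniform
   one. *)
have [|m [m_gt0 hm]] := @filter_ex _ (0^'+ : set_system R) _ _
  (filterI (nbhs_right_gt (0 : R)) (cK R (0^'+ : set_system R)
  (fun m pq => m <= g (cplx_of pq.1) (cplx_of pq.2)) _ _)).
  move=> [p q] [/= hp hq]; have [m m_gt0 [d d_gt0 h]] := hg _ _ hp hq.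
  have near_d r : \forall r' \near r, nc (cplx_of r' - cplx_of r) < d.
    apply: (@near_cplx_of r (fun z => nc (z - cplx_of r) < d) d) => // w.
    by rewrite addrC addKr.
  exists ([set x | nc (cplx_of x.1 - cplx_of p) < d /\ nc (cplx_of x.2 - cplx_of q) < d],
          [set i | i < m]) => /=.
    split; last exact: nbhs_right_lt.
    by exists ([set r | nc (cplx_of r - cplx_of p) < d],
               [set r | nc (cplx_of r - cplx_of q) < d]); first by split; exact: near_d.
  move=> [[p' q'] i] [/= [hp' hq'] /ltW im]; apply: le_trans im _.
  by have := h _ _ hp' hq'; rewrite !subrKC.
exists m => // z w hz hw.
have := hm ((Re z, Im z), (Re w, Im w)); rewrite /= !cplx_of_ReIm; apply.
by split.
Qed.
End Compactness.

Section MaximumPrinciple.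
Context {R : realType}.
Local Notation C := R[i].

(** Parseval's identity on the four displacements [t i^k]: the exponents 0, 1 and 2 are distinct
    modulo 4, so all mixed terms cancel. *)
Lemma sum4_sqr_nc (a b c : C) (t : R) :
  let s w := nc (a + b * w + c * w ^+ 2) ^+ 2 in
  s t%:C + s (- t%:C) + s (t *i) + s (- (t *i)) =
  4 * (nc a ^+ 2 + (nc b * t) ^+ 2 + (nc c * t ^+ 2) ^+ 2).
Proof.
case: a b c => [a1 a2] [b1 b2] [c1 c2] s; rewrite /s !exprMn !nc_sqrE.
by rewrite !expr2; simpc => /=; ring.
Qed.

(* At an interior maximum of [|f|^2 + eps |z|^2], average over the four
   displacements [t, -t, it, -it]: the quadratic terms do not decrease the
   average of [|f|^2] and the cubic remainder cannot compensate [eps t^2]. *)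
Lemma second_order_no_max (f : C -> C) z (eps d : R) :
  second_order f z -> 0 < eps -> 0 < d ->
  ~ (forall w, nc w < d -> nc (f (z + w)) ^+ 2 + eps * nc (z + w) ^+ 2 <=
               nc (f z) ^+ 2 + eps * nc z ^+ 2).
Proof.
move=> [b [c [e [[M [d1 [d1_gt0 he]]] [d2 d2_gt0 h]]]]] eps_gt0 d_gt0 hmax.
have M_ge0 : 0 <= M by apply: le_trans (he 0 _); rewrite ?nc_ge0 ?nc0.
pose B := nc (f z) + nc b + nc c.
have B_ge0 : 0 <= B by rewrite !addr_ge0 ?nc_ge0.
pose p w := f z + b * w + c * w ^+ 2.
pose D := Num.min (Num.min d d1) (Num.min d2 1).
have D_gt0 : 0 < D by rewrite !lt_min d_gt0 d1_gt0 d2_gt0 ltr01.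
(* For [|w| = t <= 1] the quadratic part has modulus at most [B] and the remainder at most [M t^3],
   and [|p + q|^2 >= |p|^2 - 2 |p| |q|]; hence a loss of at most [K t^3]. The radius [t] is chosen
   with [K t < eps]. *)
pose K := 2 * B * M.
have K_ge0 : 0 <= K by rewrite !mulr_ge0.
pose t := Num.min (D / 2) (eps / (2 * (K + 1))).
have t_gt0 : 0 < t by rewrite lt_min !divr_gt0// mulr_gt0// ltr_wpDl.
have tD : t < D.
  have : t <= D / 2 by rewrite ge_min lexx.
  by move: D_gt0; clearbody t D; lra.
have tK : K * t < eps.
  have : t <= eps / (2 * (K + 1)) by rewrite ge_min lexx orbT.
  rewrite ler_pdivlMr; last by rewrite mulr_gt0// ltr_wpDl.
  by have := mulr_ge0 K_ge0 (ltW t_gt0); clearbody K; lra.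
have low w : nc w = t -> nc (p w) ^+ 2 - K * t ^+ 3 <= nc (f (z + w)) ^+ 2.
  move=> wt.
  have := tD; rewrite -wt !lt_min => /andP[/andP[_ /he heM] /andP[/h -> w1]].
  have pB : nc (p w) <= B.
    apply: le_trans (ncD _ _) _; apply: lerD.
      apply: le_trans (ncD _ _) _; apply: lerD => //.
      by rewrite ncM ler_piMr ?nc_ge0 ?ltW.
    by rewrite ncM ler_piMr ?nc_ge0// ncX exprn_ile1 ?nc_ge0 ?ltW.
  have qM : nc (w ^+ 3 * e w) <= t ^+ 3 * M.
    by rewrite ncM ncX wt ler_wpM2l ?exprn_ge0// ltW.
  have := nc_ge_sub (p w) (w ^+ 3 * e w); rewrite -/(p w) => lo.
  have := nc_ge0 (p w + w ^+ 3 * e w); have := nc_ge0 (p w).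
  have : 0 <= t ^+ 3 by rewrite exprn_ge0// ltW.
  have := nc_ge0 (w ^+ 3 * e w).
  set q := nc _ in qM lo *; set P := nc (p w) in pB lo *; set S := nc (_ + _) in lo *.
  move=> q0 t3 P0 S0.
  have : P * q <= B * (t ^+ 3 * M) by rewrite ler_pM.
  have sq : P ^+ 2 - 2 * (P * q) <= S ^+ 2.
    by have [le_qP|lt_Pq] := leP q P; nra.
  by rewrite wt /K => Pq; apply: le_trans sq; lra.
have ti : nc (t%:C : C) = t by rewrite nc_real gtr0_norm.
have tii : nc (t *i : C) = t.
  by rewrite /Normc.normc /= expr0n add0r sqrtr_sqr gtr0_norm.
have dt : t < d by move: tD; rewrite !lt_min => /andP[/andP[]].
have m1 := hmax t%:C; have m2 := hmax (- t%:C).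
have m3 := hmax (t *i); have m4 := hmax (- (t *i)).
rewrite !ncN ti tii in m1 m2 m3 m4.
have := (m1 dt, m2 dt, m3 dt, m4 dt) => {m1 m2 m3 m4} [[[[m1 m2] m3] m4]].
have l1 := low _ ti; have l3 := low _ tii.
have l2 := low (- t%:C); have l4 := low (- (t *i)); rewrite !ncN in l2 l4.
have {}l2 := l2 ti; have {}l4 := l4 tii.
have S1 := sum4_sqr_nc (f z) b c t; have S2 := sum4_sqr_nc z 1 0 t.
rewrite /= -/(p _) -/(p (- t%:C)) -/(p (t *i)) -/(p (- (t *i))) in S1.
rewrite /= nc1 nc0 !mul1r !mul0r !addr0 in S2.
have t3 : K * t ^+ 3 < eps * t ^+ 2.
  by rewrite exprSr mulrCA (mulrC eps) ltr_pM2l ?exprn_gt0.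
have := sqr_ge0 (nc b * t); have := sqr_ge0 (nc c * t ^+ 2).
move: (nc (f z)) (nc (f (z + t%:C))) (nc (p t%:C)) (nc (p (- t%:C)))
  m1 m2 m3 m4 l1 l2 l3 l4 S1 S2 => *.
nra.
Qed.

Lemma nc_sqr_continuous (f : C -> C) z (eps : R) : second_order f z -> 0 < eps ->
  exists2 d : R, 0 < d &
    forall w, nc w < d -> `|nc (f (z + w)) ^+ 2 - nc (f z) ^+ 2| < eps.
Proof.
move=> hf eps_gt0; have := nc_ge0 (f z); set B := nc (f z) => B_ge0.
have K_gt0 : 0 < 2 * B + 1 by lra.
pose eta := Num.min 1 (eps / (2 * B + 1)).
have eta_gt0 : 0 < eta by rewrite lt_min ltr01 divr_gt0.
have [d d_gt0 hd] := second_order_continuous hf eta_gt0.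
exists d => // w /hd; rewrite lt_min ltr_pdivlMr// => /andP[h1 h2].
have lo := nc_ge_sub (f z) (f (z + w) - f z).
have up := ncD (f z) (f (z + w) - f z).
rewrite subrKC -/B in lo up; have := nc_ge0 (f (z + w)).
have := nc_ge0 (f (z + w) - f z).
rewrite ltr_norml; set A := nc (f (z + w)) in lo up *.
set q := nc _ in h1 h2 lo up * => q0 A0.
have : q * (A + B) <= q * (2 * B + 1) by apply: ler_wpM2l => //; lra.
by move=> h; apply/andP; split; nra.
Qed.

(** If [|f 0| > U], take [eps] to be half the gap of the squares. The maximum of [|f|^2 + eps |z|^2]
    over the closed disk is not on the circle, where the value is at most [U^2 + eps < |f 0|^2], and
    [second_order_no_max] excludes the interior. *)
Lemma maximum_principle (f : C -> C) (U : R) :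
  (forall z, nc z <= 1 -> second_order f z) ->
  (forall z, nc z = 1 -> nc (f z) <= U) -> nc (f 0) <= U.
Proof.
move=> hf hU.
have U_ge0 : 0 <= U by apply: le_trans (hU 1 _); rewrite ?nc_ge0 ?nc1.
rewrite leNgt; apply/negP => ltU.
pose eps := (nc (f 0) ^+ 2 - U ^+ 2) / 2.
have eps_gt0 : 0 < eps by rewrite divr_gt0// subr_gt0 ltr_pXn2r ?nnegrE ?nc_ge0.
have hcont z : nc z <= 1 -> forall e : R, 0 < e -> exists2 d : R, 0 < d &
    forall w, nc w < d -> `|(nc (f (z + w)) ^+ 2 + eps * nc (z + w) ^+ 2) -
      (nc (f z) ^+ 2 + eps * nc z ^+ 2)| < e.
  move=> hz e e_gt0.
  have [d1 d1_gt0 h1] := nc_sqr_continuous (hf _ hz) (divr_gt0 e_gt0 (ltr0Sn R 1)).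
  have [d2 d2_gt0 h2] := nc_sqr_continuous (second_order_id z)
    (divr_gt0 (divr_gt0 e_gt0 (ltr0Sn R 1)) eps_gt0).
  exists (Num.min d1 d2) => [|w]; first by rewrite lt_min d1_gt0.
  rewrite lt_min => /andP[/h1 l1 /h2]; rewrite ltr_pdivlMr//= => l2.
  rewrite opprD addrACA -mulrBr [ltRHS]splitr.
  apply: le_lt_trans (ler_normD _ _) _; apply: ltrD => //.
  by rewrite normrM gtr0_norm// mulrC.
have [z0 z0_le1 hmax] := @disk_attains_max R (fun z => nc (f z) ^+ 2 + eps * nc z ^+ 2) hcont.
have [z0_1|z0_lt1] := eqVneq (nc z0) 1.
  have := hmax 0; rewrite nc0 => /(_ ler01); have := hU _ z0_1.
  have := nc_ge0 (f z0).
  by rewrite z0_1 /eps; nra.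
apply: (@second_order_no_max f z0 eps (1 - nc z0)) => //; first exact: hf.
  by rewrite subr_gt0 lt_neqAle z0_lt1.
move=> w hw; apply: hmax; apply: le_trans (ncD _ _) _; lra.
Qed.

End MaximumPrinciple.

(** * Energy inequality *)

Section Energy.
Context {R : realType}.
Local Notation C := R[i].

Implicit Types (x y : C) (t : R).

Lemma exprn_lt_eps (t eps : R) : 0 <= t < 1 -> 0 < eps -> exists k, t ^+ k < eps.
Proof.
move=> /andP[t_ge0 t_lt1] eps_gt0.
have /cvgrPdist_lt/(_ _ eps_gt0) : t ^+ k @[k --> \oo] --> (0 : R).
  by apply: cvg_expr; rewrite ger0_norm.
move=> /filter_ex[k]; rewrite sub0r normrN ger0_norm ?exprn_ge0// => lt.
by exists k.
Qed.

Lemma is_derive_sum_ln (P : eqType) (s : seq P) (c K : P -> R) (t : R) :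
  (forall p, 0 < 1 - t * K p) ->
  is_derive t 1 (fun t => \sum_(p <- s) c p * - ln (1 - t * K p))
    (\sum_(p <- s) c p * (K p / (1 - t * K p))).
Proof.
move=> hK; elim: s => [|p s IH].
  under eq_fun do rewrite big_nil.
  by rewrite big_nil; exact: is_derive_cst.
pose q : {poly R} := 1 - (K p)%:P * 'X.
have qE u : q.[u] = 1 - u * K p by rewrite /q !hornerE mulrC.
have -> : (fun t => \sum_(r <- p :: s) c r * - ln (1 - t * K r)) =
    (- c p \*: (@ln R \o horner q)) + (fun t => \sum_(r <- s) c r * - ln (1 - t * K r)).
  by apply/funext => u; rewrite big_cons !fctE /= qE; congr (_ + _); rewrite mulrN -mulNr.
have q0 : 0 < q.[t] by rewrite qE.
rewrite big_cons.
have -> : c p * (K p / (1 - t * K p)) = - c p *: (q.[t]^-1 * q^`().[t]).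
  rewrite qE /q derivB derivM !derivC derivX !hornerE /GRing.scale /=; ring.
apply: is_deriveD; apply: is_deriveZ.
exact: is_derive1_comp (is_derive1_ln q0) (is_derive_poly q t).
Qed.

(** Formally, [- ln (1 - t K)] is a power series in [t K] with nonnegative coefficients. The proof
    differentiates in [t] instead: the sum vanishes at [t = 0], and its derivative is nonnegative by
    a finite geometric expansion with remainder. *)
Lemma sum_ln_ge0 (P : finType) (c K : P -> R) (t : R) :
  (forall p, `|K p| <= 1) -> (forall k, 0 <= \sum_p c p * K p ^+ k.+1) ->
  0 <= t < 1 -> 0 <= \sum_p c p * - ln (1 - t * K p).
Proof.
move=> hK hc /andP[t_ge0 t_lt1].
have hpos (u : R) : 0 <= u < 1 -> forall p, 1 - u <= 1 - u * K p.
  move=> /andP[u0 u1] p; have := hK p; rewrite ler_norml => /andP[_ k1]; nra.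
have hder (u : R) : 0 <= u < 1 -> 0 <= \sum_p c p * (K p / (1 - u * K p)).
  move=> hu; have /andP[u0 u1] := hu.
  have den p : 0 < 1 - u * K p by apply: lt_le_trans (hpos _ hu p); lra.
  rewrite leNgt; apply/negP => lt0.
  pose B := \sum_p `|c p| / (1 - u).
  have B_ge0 : 0 <= B by apply: sumr_ge0 => p _; rewrite divr_ge0//; lra.
  (* The remainder after [k] terms is at least [- u^k B]. This [k] makes it too small to account for
     a negative derivative, all other terms being nonnegative. *)
  have [|k hk] := exprn_lt_eps hu (eps := - (\sum_p c p * (K p / (1 - u * K p))) / (B + 1)).
    by rewrite divr_gt0 ?oppr_gt0// ltr_wpDl.
  have geom p n : K p / (1 - u * K p) =
      \sum_(m < n) u ^+ m * K p ^+ m.+1 + u ^+ n * K p ^+ n.+1 / (1 - u * K p).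
    elim: n => [|n IH]; first by rewrite big_ord0 expr0 mul1r expr1 add0r.
    rewrite IH big_ord_recr /= -addrA; congr (_ + _).
    by rewrite !exprS; field; exact: lt0r_neq0.
  have E : \sum_p c p * (K p / (1 - u * K p)) =
      \sum_(m < k) u ^+ m * (\sum_p c p * K p ^+ m.+1) +
      u ^+ k * \sum_p c p * (K p ^+ k.+1 / (1 - u * K p)).
    under eq_bigr => p _ do rewrite (geom p k) mulrDr mulr_sumr.
    rewrite big_split /= exchange_big /=; congr (_ + _).
      by apply: eq_bigr => m _; rewrite mulr_sumr; apply: eq_bigr => p _; ring.
    by rewrite mulr_sumr; apply: eq_bigr => p _; ring.
  have le1 : 0 <= \sum_(m < k) u ^+ m * (\sum_p c p * K p ^+ m.+1).
    by apply: sumr_ge0 => m _; rewrite mulr_ge0 ?exprn_ge0.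
  have le2 : - B <= \sum_p c p * (K p ^+ k.+1 / (1 - u * K p)).
    rewrite -sumrN; apply: ler_sum => p _.
    apply: le_trans (lerNnormlW _); last exact: lexx.
    rewrite lerN2 !normrM normfV (gtr0_norm (den p)) ler_wpM2l//.
    have := hpos _ hu p => le.
    rewrite -[leRHS]mul1r; apply: ler_pM => //.
    - by rewrite invr_ge0 ltW.
    - by rewrite normrX exprn_ile1.
    - by rewrite lef_pV2 ?posrE//; lra.
  have uk : 0 <= u ^+ k by rewrite exprn_ge0.
  move: hk; rewrite ltr_pdivlMr ?ltr_wpDl// => hk.
  have := ler_wpM2l uk le2; nra.
have cont (u : R) : 0 <= u < 1 -> is_derive u 1
   (fun t => \sum_p c p * - ln (1 - t * K p)) (\sum_p c p * (K p / (1 - u * K p))).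
  move=> hu; apply: is_derive_sum_ln => p.
  by apply: lt_le_trans (hpos _ hu p); rewrite subr_gt0; case/andP: hu.
pose f (u : R) := \sum_p c p * - ln (1 - u * K p).
have f0 : f 0 = 0.
  by rewrite /f big1// => p _; rewrite mul0r subr0 ln1 oppr0 mulr0.
rewrite -[leLHS]f0; apply: (@ger0_derive1_ndecr _ f 0 t) => //.
- move=> x; rewrite in_itv /= => /andP[x0 xt].
  by have [] := cont x _; rewrite ?ltW//= (lt_trans xt).
- move=> x; rewrite in_itv /= => /andP[x0 xt].
  have hx : 0 <= x < 1 by rewrite ltW//= (lt_trans xt).
  have dx := cont x hx.
  by rewrite derive1E (@derive_val _ _ _ _ _ _ _ dx) hder.
- apply: derivable_within_continuous => x; rewrite in_itv /= => /andP[x0 xt].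
  by have [] := cont x _; rewrite ?x0//= (le_lt_trans xt).
Qed.

(** Entrywise powers of a Gram matrix are positive semidefinite (Schur). In the induction one factor
    of the inner product is split into its three coordinates, each absorbed into the weights [q]. *)
Lemma gram_pow_ge0 (J : finType) (u v w : J -> R) (q : J -> R) (m : nat) :
  0 <= \sum_i \sum_j q i * q j * (u i * u j + v i * v j + w i * w j) ^+ m.
Proof.
elim: m q => [|m IH] q.
  under eq_bigr do under eq_bigr do rewrite expr0 mulr1.
  under eq_bigr do rewrite -mulr_sumr.
  by rewrite -mulr_suml -expr2 sqr_ge0.
have -> : \sum_i \sum_j q i * q j * (u i * u j + v i * v j + w i * w j) ^+ m.+1 =
   \sum_i \sum_j (q i * u i) * (q j * u j) * (u i * u j + v i * v j + w i * w j) ^+ m +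
   \sum_i \sum_j (q i * v i) * (q j * v j) * (u i * u j + v i * v j + w i * w j) ^+ m +
   \sum_i \sum_j (q i * w i) * (q j * w j) * (u i * u j + v i * v j + w i * w j) ^+ m.
  rewrite -!big_split; apply: eq_bigr => i _ /=.
  by rewrite -!big_split; apply: eq_bigr => j _ /=; rewrite exprS; ring.
by rewrite !addr_ge0// IH.
Qed.

(* In terms of the inverse stereographic projections [X] and [Y] of [x] and
   [y], this is [1 - t * (X . Y)]. *)
Definition sphere_kernel (t : R) (x y : C) : R :=
  1 - t + 2 * t * (nc (x - y) ^+ 2 / ((1 + nc x ^+ 2) * (1 + nc y ^+ 2))).

Definition sphere_dot (x y : C) : R :=
  1 - 2 * (nc (x - y) ^+ 2 / ((1 + nc x ^+ 2) * (1 + nc y ^+ 2))).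

Lemma sphere_kernelE t x y : sphere_kernel t x y = 1 - t * sphere_dot x y.
Proof. by rewrite /sphere_kernel /sphere_dot; ring. Qed.

Lemma onep_sqr_gt0 (r : R) : 0 < 1 + r ^+ 2.
Proof. by rewrite ltr_pwDl// sqr_ge0. Qed.

(** Stereographic coordinates, in the shape needed by [gram_pow_ge0]. *)
Lemma sphere_dotE x y (s := fun z : C => 1 + nc z ^+ 2) :
  sphere_dot x y =
    (2 * Re x / s x) * (2 * Re y / s y) + (2 * Im x / s x) * (2 * Im y / s y) +
    ((nc x ^+ 2 - 1) / s x) * ((nc y ^+ 2 - 1) / s y).
Proof.
have := lt0r_neq0 (onep_sqr_gt0 (nc x)); have := lt0r_neq0 (onep_sqr_gt0 (nc y)).
rewrite /sphere_dot /s !nc_sqrE; case: x => a b; case: y => c d /= h1 h2.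
by field; rewrite h1 h2.
Qed.

(** The fraction is a quarter of the squared chordal distance on the unit sphere; the upper bound is
    the identity [(1 + |x|^2) (1 + |y|^2) = |x - y|^2 + |1 + x^* y|^2]. *)
Lemma sphere_frac_bound x y :
  0 <= nc (x - y) ^+ 2 / ((1 + nc x ^+ 2) * (1 + nc y ^+ 2)) <= 1.
Proof.
have s_gt0 : 0 < (1 + nc x ^+ 2) * (1 + nc y ^+ 2) by rewrite mulr_gt0 ?onep_sqr_gt0.
apply/andP; split; first by rewrite divr_ge0 ?sqr_ge0// ltW.
rewrite ler_pdivrMr// mul1r.
have -> : (1 + nc x ^+ 2) * (1 + nc y ^+ 2) =
    nc (x - y) ^+ 2 + nc (1 + x^* * y) ^+ 2.
  by rewrite !nc_sqrE; case: x {s_gt0} => a b; case: y => c d /=; ring.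
by rewrite lerDl sqr_ge0.
Qed.

Lemma sphere_kernel_gt0 t x y : 0 <= t < 1 -> 0 < sphere_kernel t x y.
Proof.
move=> /andP[t0 t1]; have /andP[f0 _] := sphere_frac_bound x y.
by have := mulr_ge0 t0 f0; rewrite /sphere_kernel -mulrA; lra.
Qed.

(* The logarithmic energy of unit charges at the points [x i] and opposite unit
   charges at the points [- x i] is nonnegative. *)
Lemma prod_sphere_kernel_le (I : finType) (x : I -> C) (t : R) : 0 <= t < 1 ->
  \prod_i \prod_j sphere_kernel t (x i) (x j) <=
  \prod_i \prod_j sphere_kernel t (x i) (- x j).
Proof.
move=> ht.
pose y (p : I * bool) := if p.2 then x p.1 else - x p.1.
pose q (p : I * bool) : R := if p.2 then 1 else -1.
have A_gt0 u v : 0 < sphere_kernel t u v by exact: sphere_kernel_gt0.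
(* As [t < 1], the logarithm is finite also at coinciding points. By [sum_ln_ge0] it suffices to
   consider the powers of [sphere_dot], whose weighted sums are Gram sums. *)
have E_ge0 : 0 <= \sum_p \sum_p' q p * q p' * - ln (sphere_kernel t (y p) (y p')).
  rewrite pair_bigA /=; under eq_bigr do rewrite sphere_kernelE.
  apply: (@sum_ln_ge0 _ (fun pp => q pp.1 * q pp.2)
    (fun pp => sphere_dot (y pp.1) (y pp.2))) => //.
    move=> [p p'] /=; have := sphere_frac_bound (y p) (y p').
    by rewrite /sphere_dot; set r := _ / _ => /andP[]; rewrite ler_norml; lra.
  move=> k; rewrite -(pair_bigA _ (fun p p' => q p * q p' * sphere_dot (y p) (y p') ^+ k.+1)) /=.
  by under eq_bigr do under eq_bigr do rewrite sphere_dotE; exact: gram_pow_ge0.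
have bool_sum (F : I * bool -> R) : \sum_p F p = \sum_i (F (i, true) + F (i, false)).
  rewrite (eq_bigr (fun p => F (p.1, p.2))); last by case.
  rewrite -(pair_bigA _ (fun i b => F (i, b))) /=.
  by apply: eq_bigr => i _; rewrite big_bool.
have kNN u v : sphere_kernel t (- u) (- v) = sphere_kernel t u v.
  by rewrite /sphere_kernel -opprD !ncN.
have kN u v : sphere_kernel t (- u) v = sphere_kernel t u (- v).
  by rewrite -{1}(opprK v) kNN.
have E : \sum_p \sum_p' q p * q p' * - ln (sphere_kernel t (y p) (y p')) =
    2 * (\sum_i \sum_j ln (sphere_kernel t (x i) (- x j)) -
         \sum_i \sum_j ln (sphere_kernel t (x i) (x j))).
  rewrite -sumrB mulr_sumr bool_sum; apply: eq_bigr => i _.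
  rewrite !bool_sum -big_split -sumrB mulr_sumr; apply: eq_bigr => j _ /=.
  by rewrite /q /y /= !kNN !kN; ring.
move: E_ge0; rewrite E pmulr_rge0// subr_ge0 => le_ln.
have prod_gt0 (z : I -> I -> C) : 0 < \prod_i \prod_j sphere_kernel t (x i) (z i j).
  by apply: prodr_gt0 => i _; apply: prodr_gt0.
rewrite -ler_ln ?posrE ?prod_gt0//.
have lnE (z : I -> I -> C) : ln (\prod_i \prod_j sphere_kernel t (x i) (z i j)) =
    \sum_i \sum_j ln (sphere_kernel t (x i) (z i j)).
  have lnM (J : finType) (F : J -> R) : (forall j, 0 < F j) ->
      ln (\prod_j F j) = \sum_j ln (F j) /\ 0 < \prod_j F j.
    move=> F_gt0; elim/big_ind2: _ => [|u1 u2 v1 v2 [<- ?] [<- ?]|j _].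
    - by rewrite ln1.
    - by rewrite lnM ?posrE// mulr_gt0.
    - by [].
  rewrite (lnM _ _ _).1 => [|i]; last by apply: prodr_gt0.
  by apply: eq_bigr => i _; rewrite (lnM _ _ _).1.
by rewrite !lnE.
Qed.

End Energy.

(** * A distortion theorem for Gelfer functions *)

Section Distortion.
Context {R : realType}.
Local Notation C := R[i].
Implicit Types (x y z a u v : C) (t : R).

(** Each off-diagonal ratio is replaced by a ratio of sphere kernels at the cost of a factor close
    to [1] for [t] near [1]. The full product of kernel ratios is at most [1] by the energy
    inequality, and removing each diagonal term costs at most [2 / (1 - t)]. *)
Lemma prod_ratio_le (I : finType) (x : I -> C) (t m S : R) : 0 < t < 1 -> 0 < m ->
  (forall i j, m <= nc (x i + x j)) ->
  (forall i j, (1 + nc (x i) ^+ 2) * (1 + nc (x j) ^+ 2) <= S) ->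
  \prod_(i : I) \prod_(j : I | j != i) (nc (x i - x j) / nc (x i + x j)) ^+ 2 <=
  \prod_(i : I) (2 / (1 - t) *
     \prod_(j : I | j != i) (1 + (1 - t) / t * (S / (2 * m ^+ 2)))).
Proof.
move=> /andP[t_gt0 t_lt1] m_gt0 hm hS.
have ht : 0 <= t < 1 by rewrite ltW.
set k := 1 + (1 - t) / t * _.
pose A i j := sphere_kernel t (x i) (x j).
pose A' i j := sphere_kernel t (x i) (- x j).
have A_gt0 i j : 0 < A i j by exact: sphere_kernel_gt0.
have A'_gt0 i j : 0 < A' i j by exact: sphere_kernel_gt0.
have S_ge0 (i : I) : 0 <= S.
  by apply: (le_trans _ (hS i i)); rewrite mulr_ge0// ltW// onep_sqr_gt0.
(* The summand [1 - t] of the kernel only enlarges [A i j]. In [A' i j] it costs at most the factor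
   [k], because [m] bounds [|x i + x j|] from below and [S] bounds the denominators from above. *)
have step i j : (nc (x i - x j) / nc (x i + x j)) ^+ 2 <= k * (A i j / A' i j).
  have S0 := S_ge0 i; have mle := hm i j; have Sle := hS i j.
  have p_gt0 : 0 < nc (x i + x j) by exact: lt_le_trans (hm i j).
  have s_gt0 : 0 < (1 + nc (x i) ^+ 2) * (1 + nc (x j) ^+ 2).
    by rewrite mulr_gt0// onep_sqr_gt0.
  rewrite mulrA expr_div_n ler_pdivlMr// mulrAC ler_pdivrMr ?exprn_gt0//.
  rewrite /A /A' /sphere_kernel opprK ncN.
  have p2 : m ^+ 2 <= nc (x i + x j) ^+ 2 by rewrite ler_pXn2r ?nnegrE ?nc_ge0// ltW.
  have -> : k = 1 + (1 - t) / t * S / (2 * m ^+ 2) by rewrite /k mulrA.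
  move: (nc (x i - x j)) (nc (x i + x j)) p_gt0 p2 s_gt0 Sle => d p p_gt0 p2.
  move: (_ * _) => s s_gt0 Sle.
  have -> : d ^+ 2 * (1 - t + 2 * t * (p ^+ 2 / s)) =
     2 * t * (d ^+ 2 / s) * (p ^+ 2 * (1 + (1 - t) / t * s / (2 * p ^+ 2))).
    by field; rewrite (lt0r_neq0 p_gt0) (lt0r_neq0 t_gt0) (lt0r_neq0 s_gt0).
  have t_ge0 := ltW t_gt0; have s_ge0 := ltW s_gt0.
  have c_ge0 : 0 <= (1 - t) / t by rewrite divr_ge0// subr_ge0 ltW.
  have f_ge0 : 0 <= 2 * t * (d ^+ 2 / s).
    by apply: mulr_ge0; [apply: mulr_ge0 | rewrite divr_ge0// sqr_ge0].
  have p2_ge0 r : 0 <= 2 * r ^+ 2 :> R by rewrite mulr_ge0// sqr_ge0.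
  have k_le : 1 + (1 - t) / t * s / (2 * p ^+ 2) <= 1 + (1 - t) / t * S / (2 * m ^+ 2).
    rewrite lerD2l; apply: ler_pM.
    - exact: mulr_ge0.
    - by rewrite invr_ge0.
    - exact: ler_wpM2l.
    - by rewrite lef_pV2 ?posrE ?mulr_gt0 ?exprn_gt0// ler_pM2l.
  have q_ge0 : 0 <= 1 + (1 - t) / t * s / (2 * p ^+ 2).
    by rewrite addr_ge0// divr_ge0// mulr_ge0.
  rewrite [leLHS]mulrCA [leLHS]mulrC ler_wpM2r ?sqr_ge0// [leLHS]mulrC.
  by apply: ler_pM => //; rewrite lerDr subr_ge0 ltW.
apply: le_trans (_ : \prod_i \prod_(j | j != i) (k * (A i j / A' i j)) <= _).
  apply: ler_prod => i _; rewrite prodr_ge0 => [|j _]; last by rewrite sqr_ge0.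
  by apply: ler_prod => j _; rewrite sqr_ge0 step.
have k_ge0 (i : I) : 0 <= k.
  apply: addr_ge0 => //; apply: mulr_ge0; apply: divr_ge0.
  - by rewrite subr_ge0 ltW.
  - exact: ltW.
  - exact: S_ge0 i.
  - by rewrite mulr_ge0// sqr_ge0.
have g_gt0 i j : 0 < A i j / A' i j by rewrite divr_gt0.
under eq_bigr do rewrite big_split /=.
rewrite !big_split /= mulrC ler_wpM2r//.
  by apply: prodr_ge0 => i _; apply: prodr_ge0 => j _; exact: k_ge0 i.
(* The diagonal is put back so that the energy inequality applies. There [A i i = 1 - t] and
   [A' i i <= 1 + t <= 2]. *)
have -> : \prod_i \prod_(j | j != i) (A i j / A' i j) =
    \prod_i (A i i / A' i i)^-1 * \prod_i \prod_j (A i j / A' i j).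
  rewrite -big_split; apply: eq_bigr => i _ /=.
  by rewrite [in RHS](bigD1 i)//= mulKf ?lt0r_neq0.
have gle1 : \prod_i \prod_j (A i j / A' i j) <= 1.
  under eq_bigr do rewrite prodf_div.
  rewrite prodf_div ler_pdivrMr ?mul1r; first exact: prod_sphere_kernel_le.
  by apply: prodr_gt0 => i _; apply: prodr_gt0.
rewrite -[leRHS]mulr1; apply: ler_pM => //.
- by apply: prodr_ge0 => i _; rewrite invr_ge0 ltW.
- by apply: prodr_ge0 => i _; apply: prodr_ge0 => j _; rewrite ltW.
rewrite -big_split /=; apply: ler_prod => i _; rewrite invr_ge0 ltW//=.
rewrite invf_div ler_pdivrMr// mulrAC ler_pdivlMr ?subr_gt0//.
have A_ii : A i i = 1 - t by rewrite /A /sphere_kernel subrr nc0 expr0n mul0r mulr0 addr0.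
rewrite A_ii ler_wpM2r ?subr_ge0 ?ltW//.
have /andP[_] := sphere_frac_bound (x i) (- x i).
rewrite /A' /sphere_kernel -mulrA; move: (_ / _) => f f_le1.
by have := ler_wpM2l (ltW t_gt0) f_le1; clear -t_lt1; lra.
Qed.

(** The product of the distances from one [n]-th root of unity to the others is the modulus of the
    derivative of [X^n - 1] there, which is [n]. *)
Lemma exists_unit_roots n : (0 < n)%N -> exists zeta : 'I_n -> C,
  forall i, nc (zeta i) = 1 /\ 1 <= \prod_(j | j != i) nc (zeta i - zeta j).
Proof.
move=> n_gt0; pose p : {poly C} := 'X^n - 1.
have p_monic : p \is monic by rewrite /p -[1]/(1%:P) monicXnsubC.
have [r pE] := closed_field_poly_normal p.
rewrite (monicP p_monic) scale1r in pE.
have sr : size r = n.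
  by apply: succn_inj; rewrite -(size_prod_XsubC r id) -pE /p size_XnsubC.
exists (fun i => r`_i) => i.
have pi : p = ('X - (r`_i)%:P) * \prod_(j < n | j != i) ('X - (r`_j)%:P).
  by rewrite {1}pE (big_nth 0) sr big_mkord (bigD1 i).
have ri : r`_i ^+ n = 1.
  apply/eqP; rewrite -subr_eq0; apply/eqP.
  transitivity p.[r`_i]; first by rewrite /p !hornerE.
  by rewrite pi !hornerE subrr mul0r.
have nri : nc r`_i = 1.
  apply/eqP; rewrite -(@pexpr_eq1 _ _ n) ?nc_ge0 -?lt0n//.
  by rewrite -ncX ri nc1.
split=> //; rewrite -nc_prod.
have -> : \prod_(j < n | j != i) (r`_i - r`_j) = p^`().[r`_i].
  rewrite pi derivM !hornerE derivXsubC subrr mul0r addr0 hornerE mul1r horner_prod.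
  by apply: eq_bigr => j _; rewrite !hornerE.
rewrite /p derivB derivXn derivC subr0 hornerMn hornerXn.
rewrite -mulr_natl ncM ncX nri expr1n mulr1.
have -> : (n%:R : C) = (n%:R : R)%:C by rewrite rmorph_nat.
by rewrite nc_real ger0_norm ?ler0n// ler1n.
Qed.

(** Written without division, so that it is defined and has second-order expansions on the diagonal
    too, where it equals [p']. *)
Definition diff_quotient (p : {poly C}) u v : C :=
  \sum_(k < size p) p`_k * \sum_(l < k) u ^+ (k.-1 - l) * v ^+ l.

Lemma diff_quotientE p u v : p.[u] - p.[v] = (u - v) * diff_quotient p u v.
Proof.
rewrite !horner_coef -sumrB mulr_sumr; apply: eq_bigr => k _.
by rewrite -mulrBr subrXX; ring.
Qed.

Lemma diff_quotient_diag p a : diff_quotient p a a = p^`().[a].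
Proof.
rewrite -[in RHS](coefK p) poly_def raddf_sum horner_sum /=; apply: eq_bigr => k _.
rewrite derivZ derivXn hornerZ hornerMn hornerXn; congr (_ * _).
rewrite (eq_bigr (fun=> a ^+ k.-1)) => [|l _].
  by rewrite sumr_const card_ord.
rewrite -exprD subnK// -ltnS prednK//; exact: leq_ltn_trans (ltn_ord l).
Qed.

Lemma second_order_diff_quotient p (f g : C -> C) z :
  second_order f z -> second_order g z ->
  second_order (fun w => diff_quotient p (f w) (g w)) z.
Proof.
move=> hf hg; apply: second_order_sum => k _.
apply: second_orderM; first exact: second_order_cst.
by apply: second_order_sum => l _; apply: second_orderM; exact: second_orderX.
Qed.

Definition mobius a z : C := (z + a) / (1 + a^* * z).

Lemma mobius_den a z : nc a < 1 -> nc z <= 1 -> 1 + a^* * z != 0.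
Proof.
move=> ha hz; rewrite -nc_gt0; have := nc_ge_sub 1 (a^* * z).
rewrite nc1 ncM ncJ; have := nc_ge0 z; have := nc_ge0 a; nra.
Qed.

(** Its sign shows that the closed disk is mapped into itself; its vanishing for [|z| = 1] shows
    that the circle is preserved. *)
Lemma mobius_norm a z :
  nc (1 + a^* * z) ^+ 2 - nc (z + a) ^+ 2 = (1 - nc a ^+ 2) * (1 - nc z ^+ 2).
Proof. by rewrite !nc_sqrE; case: a => a b; case: z => c d /=; ring. Qed.

Lemma mobius_disk a z : nc a < 1 -> nc z <= 1 -> nc (mobius a z) <= 1.
Proof.
move=> ha hz; rewrite /mobius ncM ncV ler_pdivrMr ?nc_gt0 ?mobius_den// mul1r.
rewrite -(@ler_pXn2r _ 2) ?nnegrE ?nc_ge0// -subr_ge0 mobius_norm.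
by rewrite mulr_ge0 ?subr_ge0 ?exprn_ile1 ?nc_ge0// ltW.
Qed.

Lemma mobius0 a : mobius a 0 = a.
Proof. by rewrite /mobius mulr0 add0r addr0 divr1. Qed.

Lemma mobiusB a u v : nc a < 1 -> nc u <= 1 -> nc v <= 1 ->
  mobius a u - mobius a v =
  (u - v) * ((1 - (nc a ^+ 2)%:C) / ((1 + a^* * u) * (1 + a^* * v))).
Proof.
move=> ha hu hv; have := mobius_den ha hu; have := mobius_den ha hv.
have -> : (nc a ^+ 2)%:C = a^* * a.
  by rewrite nc_sqrE; case: a {ha} => a b; simpc; congr (_ +i* _); ring.
by move=> h1 h2; rewrite /mobius; field; rewrite h1 h2.
Qed.

Lemma second_order_mobius a z : nc a < 1 -> nc z <= 1 ->
  second_order (mobius a) z.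
Proof.
move=> ha hz; apply: second_orderM.
  by apply: second_orderD; [exact: second_order_id | exact: second_order_cst].
apply: second_orderV; last exact: mobius_den.
apply: second_orderD; first exact: second_order_cst.
by apply: second_orderM; [exact: second_order_cst | exact: second_order_id].
Qed.

(* With [x i = h (T (z zeta_i))], the quotient [(x i - x j) / (x i + x j)] equals
   [z (zeta_i - zeta_j) psi (z zeta_i) (z zeta_j)], where [psi] is holomorphic and
   [|psi 0 0|] is the ratio [rho] to be bounded by [1]. *)
Lemma gelfer_distortion (h : C -> C) (p : {poly C}) a :
  (forall z, nc z <= 1 -> second_order h z) ->
  (forall z, nc z <= 1 -> h z ^+ 2 = p.[z]) ->
  (forall z w, nc z <= 1 -> nc w <= 1 -> h z + h w != 0) ->
  nc a < 1 -> nc p^`().[a] * (1 - nc a ^+ 2) <= 4 * nc p.[a].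
Proof.
move=> hh h2 hne ha.
(* By compactness the Gelfer condition becomes uniform. Neither [m] nor the [S] below depends on the
   number of points used later. *)
have [m m_gt0 hm] : exists2 m : R, 0 < m &
    forall z w, nc z <= 1 -> nc w <= 1 -> m <= nc (h z + h w).
  apply: disk2_bounded_away0 => z w hz hw.
  have d_gt0 : 0 < nc (h z + h w) / 4 by rewrite divr_gt0 ?nc_gt0 ?hne.
  exists (nc (h z + h w) / 4) => //.
  have [d1 d1_gt0 h1] := second_order_continuous (hh _ hz) d_gt0.
  have [d2 d2_gt0 h2'] := second_order_continuous (hh _ hw) d_gt0.
  exists (Num.min d1 d2) => [|z' w']; first by rewrite lt_min d1_gt0.
  rewrite !lt_min => /andP[/h1 l1 _] /andP[_ /h2' l2].
  have := nc_ge_sub (h z + h w) ((h (z + z') - h z) + (h (w + w') - h w)).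
  have := ncD (h (z + z') - h z) (h (w + w') - h w).
  have -> : h z + h w + (h (z + z') - h z + (h (w + w') - h w)) =
    h (z + z') + h (w + w') by ring.
  lra.
have [z1 z1_le1 hmax] := @disk_attains_max R (fun z => nc (h z) ^+ 2)
  (fun z hz e e_gt0 => nc_sqr_continuous (hh z hz) e_gt0).
pose S := (1 + nc (h z1) ^+ 2) * (1 + nc (h z1) ^+ 2).
have S_gt0 : 0 < S by rewrite mulr_gt0 ?onep_sqr_gt0.
have hS z w : nc z <= 1 -> nc w <= 1 -> (1 + nc (h z) ^+ 2) * (1 + nc (h w) ^+ 2) <= S.
  by move=> hz hw; rewrite ler_pM ?lerD2l ?hmax// ltW ?onep_sqr_gt0.
have ha2 : h a ^+ 2 = p.[a] by rewrite h2// ltW.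
have pa_gt0 : 0 < nc p.[a].
  rewrite -ha2 ncX exprn_gt0// nc_gt0; apply/eqP => ha0.
  by have := hne a a (ltW ha) (ltW ha); rewrite ha0 addr0 eqxx.
pose rho := nc p^`().[a] * (1 - nc a ^+ 2) / (4 * nc p.[a]).
suff : rho ^+ 2 <= 1.
  rewrite expr_le1//; last first.
    by rewrite divr_ge0 ?mulr_ge0 ?nc_ge0// subr_ge0 exprn_ile1 ?nc_ge0 ?ltW.
  by rewrite /rho ler_pdivrMr ?mulr_gt0// mul1r.
pose psi u v := diff_quotient p (mobius a u) (mobius a v) *
  ((1 - (nc a ^+ 2)%:C) / ((1 + a^* * u) * (1 + a^* * v))) /
  (h (mobius a u) + h (mobius a v)) ^+ 2.
have psi0 : nc (psi 0 0) = rho.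
  rewrite /psi mobius0 diff_quotient_diag !mulr0 !addr0 mulr1 divr1.
  have n1a : nc (1 - (nc a ^+ 2)%:C) = 1 - nc a ^+ 2.
    rewrite -[1 in LHS]/(1%:C) -rmorphB nc_real ger0_norm//.
    by rewrite subr_ge0 exprn_ile1 ?nc_ge0 ?ltW.
  have n2 : nc (2 : C) = 2.
    by rewrite -[2 in LHS](rmorph_nat (real_complex R)) nc_real ger0_norm.
  rewrite -mulr2n -mulr_natl exprMn ha2 !(ncM, ncV, ncX) n1a n2 /rho.
  by congr (_ / (_ * _)); ring.
(* Since [h^2 = p], the difference of the values of [p] is [(h - h') (h + h')]; dividing by
   [(h + h')^2] leaves the quotient on the right. *)
have psiE z u v : nc z = 1 -> nc u = 1 -> nc v = 1 -> nc (psi (z * u) (z * v)) * nc (u - v) =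
   nc (h (mobius a (z * u)) - h (mobius a (z * v))) /
   nc (h (mobius a (z * u)) + h (mobius a (z * v))).
  move=> hz hu hv.
  have hzu : nc (z * u) <= 1 by rewrite ncM hz hu mulr1.
  have hzv : nc (z * v) <= 1 by rewrite ncM hz hv mulr1.
  have Tu := mobius_disk ha hzu; have Tv := mobius_disk ha hzv.
  have -> : nc (u - v) = nc (z * u - z * v) by rewrite -mulrBr ncM hz mul1r.
  have sum0 := hne _ _ Tu Tv.
  rewrite -ncV -!ncM; congr nc; apply: (mulIf sum0); rewrite divfK//.
  apply: (mulIf sum0); rewrite -[RHS]subr_sqr !h2// diff_quotientE mobiusB//.
  have du := mobius_den ha hzu; have dv := mobius_den ha hzv.
  by rewrite /psi; field; rewrite sum0 du dv.
have hso (u v : C) z : nc u = 1 -> nc v = 1 -> nc z <= 1 ->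
    second_order (fun z => psi (z * u) (z * v)) z.
  move=> hu hv hz.
  have hzu : nc (z * u) <= 1 by rewrite ncM hu mulr1.
  have hzv : nc (z * v) <= 1 by rewrite ncM hv mulr1.
  have Tu := mobius_disk ha hzu; have Tv := mobius_disk ha hzv.
  have lin w : second_order (fun z => z * w) z.
    by apply: second_orderM; [exact: second_order_id | exact: second_order_cst].
  have den w : second_order (fun z => 1 + a^* * (z * w)) z.
    apply: second_orderD; first exact: second_order_cst.
    by apply: second_orderM; [exact: second_order_cst | exact: lin].
  have mob w : nc (z * w) <= 1 -> second_order (fun z => mobius a (z * w)) z.
    by move=> hzw; apply: second_order_comp (lin w) _; exact: second_order_mobius.
  have hmob w : nc (z * w) <= 1 -> second_order (fun z => h (mobius a (z * w))) z.
    move=> hzw; apply: (second_order_comp (mob _ hzw)).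
    by apply: hh; exact: mobius_disk.
  apply: second_orderM; first apply: second_orderM.
  - by apply: second_order_diff_quotient; exact: mob.
  - apply: second_orderM; first exact: second_order_cst.
    apply: second_orderV; first by apply: second_orderM; exact: den.
    by rewrite mulf_neq0 ?mobius_den.
  - apply: second_orderV; last by rewrite expf_neq0 ?hne.
    by apply: second_orderX; apply: second_orderD; exact: hmob.
(* The maximum principle is applied to the product [phi] over ordered pairs of distinct [n.+1]-th
   roots of unity. At [0] each of its [n (n + 1)] factors has modulus [rho^2], and on the circle
   [phi] is at most [U^(n + 1)]; an [n.+1]-th root is then taken. *)
have main n t : 0 < t < 1 -> (rho ^+ 2) ^+ n <=
    2 / (1 - t) * (1 + (1 - t) / t * (S / (2 * m ^+ 2))) ^+ n.
  move=> ht; have [zeta hzeta] := @exists_unit_roots n.+1 isT.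
  pose phi z := \prod_i \prod_(j | j != i) psi (z * zeta i) (z * zeta j) ^+ 2.
  set k := 1 + (1 - t) / t * _; set U := _ * _.
  have U_ge0 : 0 <= U.
    have /andP[t0 t1] := ht.
    have k_ge0 : 0 <= k.
      apply: addr_ge0 => //; apply: mulr_ge0; apply: divr_ge0.
      - by rewrite subr_ge0 ltW.
      - exact: ltW.
      - exact: ltW.
      - by rewrite mulr_ge0// sqr_ge0.
    by rewrite mulr_ge0 ?exprn_ge0// divr_ge0// subr_ge0 ltW.
  have phi_norm z : nc (phi z) =
      \prod_i \prod_(j | j != i) nc (psi (z * zeta i) (z * zeta j)) ^+ 2.
    rewrite /phi nc_prod; apply: eq_bigr => i _.
    by rewrite nc_prod; apply: eq_bigr => j _; rewrite ncX.
  have const_prod (c : R) (i : 'I_n.+1) : \prod_(j < n.+1 | j != i) c = c ^+ n.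
    by rewrite prodr_const cardC1 card_ord.
  have : nc (phi 0) <= U ^+ n.+1.
    apply: maximum_principle => z hz.
      apply: second_order_prod => i _; apply: second_order_prod => j _.
      by apply: second_orderX; apply: hso; rewrite ?(hzeta _).1.
    pose x i := h (mobius a (z * zeta i)).
    have hzz i : nc (mobius a (z * zeta i)) <= 1.
      by apply: mobius_disk => //; rewrite ncM hz (hzeta i).1 mulr1.
    apply: le_trans (_ : \prod_i \prod_(j | j != i) (nc (x i - x j) / nc (x i + x j)) ^+ 2 <= _).
      rewrite phi_norm; apply: ler_prod => i _.
      apply/andP; split; first by apply: prodr_ge0 => j _; rewrite sqr_ge0.
      (* The distances between the roots of unity can be inserted, since for each [i] their product
         is at least [1]. *)
      have z_ge1 : 1 <= \prod_(j | j != i) nc (zeta i - zeta j) ^+ 2.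
        rewrite prodrXl exprn_ege1//; exact: (hzeta i).2.
      rewrite [leRHS](eq_bigr (fun j => nc (psi (z * zeta i) (z * zeta j)) ^+ 2 *
                         nc (zeta i - zeta j) ^+ 2)) => [|j _].
        rewrite [leRHS]big_split /=; apply: ler_peMr => //.
        by apply: prodr_ge0 => j _; exact: sqr_ge0.
      by rewrite -exprMn psiE// ?(hzeta _).1.
    apply: le_trans (prod_ratio_le ht m_gt0 _ _) _ => [i j|i j|].
    - exact: hm.
    - exact: hS.
    - rewrite (eq_bigr (fun=> U)) => [|i _]; first by rewrite prodr_const card_ord.
      by rewrite const_prod.
  rewrite phi_norm (eq_bigr (fun=> (rho ^+ 2) ^+ n)) => [|i _].
    by rewrite prodr_const card_ord ler_pXn2r// nnegrE// exprn_ge0// sqr_ge0.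
  by under eq_bigr do rewrite !mul0r psi0; exact: const_prod.
rewrite leNgt; apply/negP => rho_gt1.
pose s := S / (2 * m ^+ 2).
have s_ge0 : 0 <= s by rewrite divr_ge0 ?(ltW S_gt0)// mulr_ge0// sqr_ge0.
pose d := rho ^+ 2 - 1.
have d_gt0 : 0 < d by rewrite subr_gt0.
(* Chosen so that [(1 - t) / t = d / (s + 1)]. Then [k = 1 + d s / (s + 1)] is less than
   [1 + d = rho^2], and the inequality [main] fails for large [n]. *)
pose t := (s + 1) / (s + 1 + d).
have sd_gt0 : 0 < s + 1 + d by lra.
have ht : 0 < t < 1.
  rewrite /t ltr_pdivrMr// mul1r ltrDl d_gt0 andbT divr_gt0//; lra.
pose k := 1 + (1 - t) / t * s.
have kE : k = 1 + d * s / (s + 1).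
  have s1 : s + 1 != 0 by rewrite lt0r_neq0//; lra.
  by rewrite /k /t; field; rewrite s1 (lt0r_neq0 sd_gt0).
have s1_gt0 : 0 < s + 1 by lra.
have r_gt0 : 0 < rho ^+ 2 by lra.
have k_lt : 0 <= k / rho ^+ 2 < 1.
  have k_ge0 : 0 <= k.
    rewrite kE; apply: addr_ge0 => //; apply: divr_ge0; last exact: ltW.
    exact: mulr_ge0 (ltW d_gt0) s_ge0.
  rewrite divr_ge0 ?sqr_ge0//= ltr_pdivrMr// mul1r kE.
  have -> : rho ^+ 2 = 1 + d by rewrite /d subrKC.
  by rewrite ltrD2l ltr_pdivrMr// ltr_pM2l// ltrDl.
have [|n hn] := exprn_lt_eps k_lt (eps := (1 - t) / 2).
  by rewrite divr_gt0// subr_gt0; case/andP: ht.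
have := main n t ht; rewrite -/s -/k leNgt => /negP; apply.
move: hn; rewrite expr_div_n ltr_pdivrMr => [hn|]; last exact: exprn_gt0.
rewrite -[ltLHS]mulrC -invf_div; rewrite ltr_pdivrMr; first by rewrite mulrC.
by rewrite divr_gt0// subr_gt0; case/andP: ht.
Qed.

End Distortion.

(** * Growth *)

Section Growth.
Context {R : realType}.
Local Notation C := R[i].
Implicit Types (z w a : C) (p : {poly C}).

(** The principal root maps the right half-plane into the sector of arguments below [pi / 4] in
    absolute value. A quotient of two points of this sector has nonnegative real part, which is the
    branch condition of [second_order_root]. *)
Lemma Re_sqrtc_gt0 z : 0 < Re z ->
  0 < Re (sqrtc z) /\ Im (sqrtc z) ^+ 2 < Re (sqrtc z) ^+ 2.
Proof.
move=> z_gt0; have ge0 : 0 <= Re (sqrtc z) by case: z {z_gt0} => a b; exact: sqrtr_ge0.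
have := sqr_sqrtc z; move: z_gt0 ge0; case: (sqrtc z) => a b /= z_gt0 a_ge0 zE.
move: z_gt0; rewrite -zE expr2; simpc => /= ab; split; last by rewrite !expr2; lra.
by rewrite lt_def a_ge0 andbT; apply/eqP => a0; rewrite a0 in ab; nra.
Qed.

Lemma Re_div_ge0 z w : 0 < Re z -> Im z ^+ 2 < Re z ^+ 2 ->
  0 < Re w -> Im w ^+ 2 < Re w ^+ 2 -> 0 <= Re (z / w).
Proof.
have lt_norm (u v : R) : 0 < u -> v ^+ 2 < u ^+ 2 -> - u < v < u.
  move=> u0 vu; rewrite -ltr_norml -(@ltr_pXn2r _ 2) ?nnegrE//; last exact: ltW.
  by rewrite real_normK ?num_real.
case: z => a b; case: w => c d /= a0 /(lt_norm _ _ a0)/andP[b1 b2].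
move=> c0 /(lt_norm _ _ c0)/andP[d1 d2].
rewrite mulrN opprK !mulrA -mulrDl; apply: divr_ge0.
  by have [b_ge0|b_lt0] := leP 0 b; nra.
by rewrite addr_ge0 ?sqr_ge0.
Qed.

Lemma second_order_sqrtc zeta z : nc z < nc zeta ->
  second_order (fun w => sqrtc (1 - w / zeta)) z.
Proof.
move=> zlt; have zeta_gt0 : 0 < nc zeta by apply: le_lt_trans zlt; exact: nc_ge0.
have Re_gt0 w : nc w < nc zeta -> 0 < Re (1 - w / zeta).
  move=> wlt; rewrite raddfB /= subr_gt0.
  apply: le_lt_trans (ler_norm _) _; apply: le_lt_trans (Re_le_nc _) _.
  by rewrite ncM ncV ltr_pdivrMr// mul1r.
have hs w : nc w < nc zeta - nc z -> nc (z + w) < nc zeta.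
  by move=> hw; apply: le_lt_trans (ncD _ _) _; lra.
apply: (@second_order_root _ (fun w => 1 - w / zeta) _ _ (nc zeta - nc z)).
- by rewrite subr_gt0.
- by move=> w _; rewrite sqr_sqrtc.
- apply: second_orderD; first exact: second_order_cst.
  by apply: second_orderN; apply: second_orderM;
    [exact: second_order_id | exact: second_order_cst].
- have [+ _] := Re_sqrtc_gt0 (Re_gt0 _ zlt).
  by apply: contraTneq => ->; rewrite ltxx.
- move=> w /hs/Re_gt0/Re_sqrtc_gt0[h1 h2].
  by have [h3 h4] := Re_sqrtc_gt0 (Re_gt0 _ zlt); exact: Re_div_ge0.
Qed.

(** All roots of [p] lie outside the closed disk, so [p] is a product of factors [1 - z / x] with
    values in the right half-plane, and the principal roots of the factors are multiplied. *)
Lemma exists_sqrt p : p.[0] = 1 -> (forall z, nc z <= 1 -> p.[z] != 0) ->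
  exists h : C -> C, [/\ h 0 = 1, forall z, h z ^+ 2 = p.[z] &
    forall z, nc z <= 1 -> second_order h z].
Proof.
move=> p0 pne; have [r pE] := closed_field_poly_normal p.
have lead0 : lead_coef p != 0.
  by rewrite lead_coef_eq0; apply/eqP => pz; move: p0; rewrite pz horner0 => /esym/eqP;
    rewrite oner_eq0.
have r_gt1 x : x \in r -> 1 < nc x.
  move=> xr; rewrite ltNge; apply/negP => /pne /negP; apply.
  by rewrite pE hornerZ mulf_eq0 (negPf lead0) -rootE root_prod_XsubC.
have hpE z : p.[z] = \prod_(x <- r) (1 - z / x).
  rewrite -[RHS]mul1r -{1}p0 pE !hornerZ !horner_prod -mulrA -big_split /=; congr (_ * _).
  apply: eq_big_seq => x /r_gt1 x1; rewrite !hornerE.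
  by field; rewrite -nc_gt0 (lt_trans ltr01).
exists (fun z => \prod_(x <- r) sqrtc (1 - z / x)); split.
- by rewrite big1// => x _; rewrite mul0r subr0 sqrtc1.
- by move=> z; rewrite -prodrXl hpE; apply: eq_bigr => x _; rewrite sqr_sqrtc.
(* The product is reindexed with the condition [x \in r], which provides [1 < |x|] for each
   factor. *)
- move=> z hz; rewrite -[r]filter_predT.
  have -> : [seq x <- r | predT x] = [seq x <- r | x \in r].
    by apply: eq_in_filter => x xr; rewrite xr.
  apply: (@second_order_eq _ (fun w => \prod_(x <- r | x \in r) sqrtc (1 - w / x)) _ _ 1) => //.
    by move=> w _; rewrite big_filter.
  by apply: second_order_prod => x /r_gt1 x1; apply: second_order_sqrtc; exact: le_lt_trans x1.
Qed.

(** On the real axis the real and imaginary parts of [p] are real polynomials, so [|p|^2] becomes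
    one that can be differentiated formally. *)
Lemma horner_map_Re p (x : R) : (map_poly (@complex.Re R) p).[x] = Re p.[x%:C].
Proof.
rewrite /map_poly horner_poly horner_coef raddf_sum; apply: eq_bigr => k _ /=.
by rewrite -rmorphXn /=; case: (p`_k) => a b /=; ring.
Qed.

Lemma horner_map_Im p (x : R) : (map_poly (@complex.Im R) p).[x] = Im p.[x%:C].
Proof.
rewrite /map_poly horner_poly horner_coef raddf_sum; apply: eq_bigr => k _ /=.
by rewrite -rmorphXn /=; case: (p`_k) => a b /=; ring.
Qed.

Lemma deriv_map_Re p : (map_poly (@complex.Re R) p)^`() = map_poly (@complex.Re R) p^`().
Proof.
by apply/polyP => k; rewrite coef_deriv !coef_map_id0// coef_deriv raddfMn.
Qed.

Lemma deriv_map_Im p : (map_poly (@complex.Im R) p)^`() = map_poly (@complex.Im R) p^`().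
Proof.
by apply/polyP => k; rewrite coef_deriv !coef_map_id0// coef_deriv raddfMn.
Qed.

(** Along the radius through [z], the polynomial [Q = |p|^2] satisfies [Q' (1 - x^2) <= 8 Q]. As
    [((1 + x) / (1 - x))^4] has logarithmic derivative [8 / (1 - x^2)], the quotient of [Q] by it,
    here [N / D], does not increase from its value [1] at [0]. *)
Lemma growth_bound p z :
  (forall a, nc a < 1 -> nc p^`().[a] * (1 - nc a ^+ 2) <= 4 * nc p.[a]) ->
  p.[0] = 1 -> nc z < 1 -> nc p.[z] <= ((1 + nc z) / (1 - nc z)) ^+ 2.
Proof.
move=> hp p0 z_lt1.
have [->|z0] := eqVneq z 0; first by rewrite p0 nc0 nc1 addr0 subr0 divr1 expr1n.
pose r := nc z; have r_gt0 : 0 < r by rewrite /r nc_gt0.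
pose e := z / r%:C.
have ne : nc e = 1 by rewrite ncM ncV nc_real gtr0_norm// divff// lt0r_neq0.
pose q := p \Po (e *: 'X).
have qE (x : R) : q.[x%:C] = p.[e * x%:C] by rewrite horner_comp hornerZ hornerX.
have q'E (x : R) : nc q^`().[x%:C] = nc p^`().[e * x%:C].
  rewrite deriv_comp hornerM derivZ derivX horner_comp !hornerZ hornerX hornerC.
  by rewrite mulr1 ncM ne mulr1.
have nex (x : R) : 0 <= x -> nc (e * x%:C) = x.
  by move=> x0; rewrite ncM ne mul1r nc_real ger0_norm.
clearbody q.
pose A := map_poly (@complex.Re R) q; pose B := map_poly (@complex.Im R) q.
pose Q := A ^+ 2 + B ^+ 2.
have QE x : Q.[x] = nc q.[x%:C] ^+ 2.
  by rewrite /Q !hornerE horner_map_Re horner_map_Im nc_sqrE.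
have Q' (x : R) : 0 <= x < 1 -> Q^`().[x] * (1 - x ^+ 2) <= 8 * Q.[x].
  move=> /andP[x0 x1].
  have : Q^`().[x] <= 2 * (nc q.[x%:C] * nc q^`().[x%:C]).
    rewrite /Q derivD !expr2 !derivM !hornerD !hornerM deriv_map_Re deriv_map_Im.
    rewrite !horner_map_Re !horner_map_Im.
    have <- : nc ((q.[x%:C])^* * q^`().[x%:C]) = nc q.[x%:C] * nc q^`().[x%:C].
      by rewrite ncM ncJ.
    have := le_trans (ler_norm _) (Re_le_nc ((q.[x%:C])^* * q^`().[x%:C])).
    by case: (q.[x%:C]) => a b; case: (q^`().[x%:C]) => c d /=; lra.
  have := hp (e * x%:C); rewrite nex// -q'E -qE QE => /(_ x1).
  have x2 : 0 < 1 - x ^+ 2 by rewrite subr_gt0 exprn_ilt1.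
  have := nc_ge0 q.[x%:C].
  move: (nc q.[x%:C]) (nc q^`().[x%:C]) (1 - x ^+ 2) (Q^`().[x]) x2 => u v y Qx y0 u0 h1 h2.
  apply: le_trans (_ : 2 * (u * v) * y <= _); first by apply: ler_wpM2r => //; exact: ltW.
  by have := ler_wpM2l u0 h1; lra.
clearbody Q; pose N := Q * (1 - 'X) ^+ 4; pose D : {poly R} := (1 + 'X) ^+ 4.
have NE (x : R) : N.[x] = Q.[x] * (1 - x) ^+ 4.
  by rewrite /N hornerM horner_exp hornerD hornerN hornerX hornerC.
have DE (x : R) : D.[x] = (1 + x) ^+ 4 by rewrite horner_exp hornerD hornerX hornerC.
have D_gt0 (x : R) : 0 <= x -> 0 < D.[x] by move=> x0; rewrite DE exprn_gt0// ltr_pwDl.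
have der (x : R) : 0 <= x -> is_derive x 1 (horner N * (fun y => (D.[y])^-1))
   (N.[x] *: (- D.[x] ^- 2 *: D^`().[x]) + (D.[x])^-1 *: N^`().[x]).
  move=> x0; apply: is_deriveM; apply: is_deriveV; exact: lt0r_neq0 (D_gt0 x x0).
have der_le0 (x : R) : 0 <= x < 1 ->
    N.[x] *: (- D.[x] ^- 2 *: D^`().[x]) + (D.[x])^-1 *: N^`().[x] <= 0.
  move=> hx; have /andP[x0 x1] := hx.
  have D0 := D_gt0 x x0.
  have -> : N.[x] *: (- D.[x] ^- 2 *: D^`().[x]) + (D.[x])^-1 *: N^`().[x] =
      (1 - x) ^+ 3 * (1 + x) ^+ 3 * (Q^`().[x] * (1 - x ^+ 2) - 8 * Q.[x]) / D.[x] ^+ 2.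
    rewrite /GRing.scale /=.
    have -> : N^`().[x] = Q^`().[x] * (1 - x) ^+ 4 - 4 * Q.[x] * (1 - x) ^+ 3.
      rewrite /N derivM deriv_exp derivB derivX derivC !hornerE /=; ring.
    have -> : D^`().[x] = 4 * (1 + x) ^+ 3.
      rewrite /D deriv_exp derivD derivX derivC !hornerE /=; ring.
    rewrite NE DE; field.
    by rewrite lt0r_neq0// ltr_pwDl.
  rewrite mulr_le0_ge0 ?invr_ge0 ?sqr_ge0// mulr_ge0_le0 ?subr_le0 ?Q'//.
  by apply: mulr_ge0; apply: exprn_ge0; [rewrite subr_ge0 ltW | rewrite addr_ge0].
pose f : R -> R := horner N * (fun y => (D.[y])^-1).
have f_le : f r <= f 0.
  apply: (@ler0_derive1_nincr _ f 0 r) => //; last exact: ltW.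
  - by move=> x; rewrite in_itv /= => /andP[/ltW/der[]].
  - move=> x; rewrite in_itv /= => /andP[/ltW x0 xr].
    have dx := der x x0.
    by rewrite derive1E (@derive_val _ _ _ _ _ _ _ dx) der_le0// x0 (lt_trans xr).
  - by apply: derivable_within_continuous => x; rewrite in_itv /= => /andP[/der[]].
have er : e * r%:C = z by rewrite /e divfK// -nc_eq0 nc_real normr_eq0 lt0r_neq0.
have f0 : f 0 = 1.
  by rewrite /f /= !fctE NE DE QE qE mulr0 p0 nc1 subr0 addr0 !expr1n mulr1 divr1.
have fr : f r = nc p.[z] ^+ 2 * (1 - r) ^+ 4 / (1 + r) ^+ 4.
  by rewrite /f !fctE /N /D !hornerE QE qE er.
have r1 : 0 < 1 - r by rewrite subr_gt0.
have rp : 0 < 1 + r by rewrite ltr_wpDr ?ltW.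
move: f_le; rewrite f0 fr ler_pdivrMr ?exprn_gt0// mul1r => le.
rewrite expr_div_n ler_pdivlMr ?exprn_gt0//.
rewrite -(@ler_pXn2r _ 2)//; first by rewrite exprMn -!exprM.
  by rewrite nnegrE mulr_ge0 ?sqr_ge0 ?nc_ge0.
by rewrite nnegrE sqr_ge0.
Qed.

(** The automorphism [mobius a] moves the centre to [a] and preserves the circle. *)
Lemma maximum_principle_at (f : C -> C) (U : R) a :
  (forall z, nc z <= 1 -> second_order f z) ->
  (forall z, nc z = 1 -> nc (f z) <= U) -> nc a < 1 -> nc (f a) <= U.
Proof.
move=> hf hU ha; rewrite -[a]mobius0.
apply: (@maximum_principle _ (fun z => f (mobius a z))) => z hz.
  apply: second_order_comp; first exact: second_order_mobius.
  by apply: hf; exact: mobius_disk.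
apply: hU; rewrite /mobius ncM ncV.
have -> : nc (z + a) = nc (1 + a^* * z); last first.
  by rewrite divff// nc_eq0 mobius_den ?hz.
apply/eqP; rewrite -(@eqrXn2 _ 2) ?nc_ge0// -subr_eq0 -opprB mobius_norm hz.
by rewrite expr1n subrr mulr0 oppr0.
Qed.

(* Bernstein-Walsh: the reversed polynomial [z^n p(r / z)] is bounded by [K] on
   the unit circle, hence at [r]. *)
Lemma poly_growth_le p n (r K : R) : (size p <= n.+1)%N -> 0 < r < 1 ->
  (forall w, nc w = r -> nc p.[w] <= K) -> r ^+ n * nc p.[1] <= K.
Proof.
move=> sp /andP[r0 r1] hK.
pose f z : C := \sum_(k < n.+1) p`_k * (r%:C ^+ k * z ^+ (n - k)).
have nr : nc (r%:C : C) = r by rewrite nc_real gtr0_norm.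
have fr : f r%:C = r%:C ^+ n * p.[1].
  rewrite (horner_coef_wide _ sp) mulr_sumr; apply: eq_bigr => k _.
  have kn : (k <= n)%N by rewrite -ltnS.
  by rewrite expr1n mulr1 -exprD (subnKC kn) mulrC.
have -> : r ^+ n * nc p.[1] = nc (f r%:C) by rewrite fr ncM ncX nr.
apply: maximum_principle_at; last by rewrite nr.
  move=> z _; apply: second_order_sum => k _; apply: second_orderM; first exact: second_order_cst.
  apply: second_orderM; first exact: second_order_cst.
  by apply: second_orderX; exact: second_order_id.
move=> z hz; have z0 : z != 0 by rewrite -nc_gt0 hz.
have -> : f z = z ^+ n * p.[r%:C / z].
  rewrite (horner_coef_wide _ sp) mulr_sumr; apply: eq_bigr => k _.
  have kn : (k <= n)%N by rewrite -ltnS.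
  have -> : z ^+ n = z ^+ (n - k) * z ^+ k by rewrite -exprD subnK.
  rewrite expr_div_n; field.
  by rewrite expf_neq0.
by rewrite ncM ncX hz expr1n mul1r hK// ncM ncV hz nr invr1 mulr1.
Qed.

(** For [n >= 2], [(1 + 2 / n)^n <= e^2 <= 9] and [9 (1 + (n + 1)^2) <= 27 n^2]. The latter fails
    for [n = 1], which is computed directly. *)
Lemma expn_bound n : (0 < n)%N ->
  (1 + (n%:R + 1) ^+ 2) * ((n%:R + 2) / n%:R) ^+ n <= 27 * n%:R ^+ 2 :> R.
Proof.
case: n => [//|[_|n _]]; first by rewrite !expr1; lra.
set m : R := n.+2%:R.
have m2 : 2 <= m by rewrite /m ler_nat.
have m0 : 0 < m by lra.
have e9 : ((m + 2) / m) ^+ n.+2 <= 9.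
  have le1 : (m + 2) / m <= expR (2 / m).
    by rewrite mulrDl divff ?expR_ge1Dx// lt0r_neq0.
  apply: le_trans (_ : expR (2 / m) ^+ n.+2 <= _).
    by rewrite ler_pXn2r ?nnegrE ?expR_ge0// divr_ge0//; lra.
  rewrite -expRM_natr -/m divfK ?lt0r_neq0//.
  (* From [e^(-1/6) >= 5/6] follows [e^2 <= (6/5)^12], about [8.92]. *)
  have -> : 2 = 6^-1 * 12%:R :> R by lra.
  rewrite expRM_natr; apply: le_trans (_ : (6 / 5) ^+ 12 <= _); last first.
    rewrite -[12%N]/(3 * 2 * 2)%N !exprM.
    have : (6 / 5 : R) ^+ 3 <= 173 / 100 by lra.
    have : 0 <= (6 / 5 : R) ^+ 3 by apply: exprn_ge0; lra.
    move: (_ ^+ 3) => a a_ge0 a_le; have a2 : a ^+ 2 <= 3 by nra.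
    by have := sqr_ge0 a; nra.
  rewrite ler_pXn2r//; [|by rewrite nnegrE expR_ge0|by rewrite nnegrE; lra].
  rewrite -[6^-1]opprK expRN -[6 / 5]invrK lef_pV2; first 1 last.
  - by rewrite posrE expR_gt0.
  - by rewrite posrE; lra.
  by apply: le_trans (expR_ge1Dx _); lra.
apply: le_trans (_ : (1 + (m + 1) ^+ 2) * 9 <= _); last by nra.
by rewrite ler_wpM2l// addr_ge0// sqr_ge0.
Qed.

End Growth.

(** * Square roots along null-homotopic loops *)

Section SquareRootAlongLoop.
Context {R : realType}.
Local Notation C := R[i].
Implicit Types (z w c : C) (f g s : R -> C).

(** Continuity on the unit interval in epsilon-delta form with real moduli, which combines directly
    with [second_order_continuous]. *)
Definition continuous01 f : Prop := forall t : R, 0 <= t <= 1 ->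
  forall eps : R, 0 < eps -> exists2 d : R, 0 < d &
    forall u : R, 0 <= u <= 1 -> `|u - t| < d -> nc (f u - f t) < eps.

Lemma continuous01_cst c : continuous01 (fun=> c).
Proof. by move=> t _ eps eps_gt0; exists 1 => // u _ _; rewrite subrr nc0. Qed.

Lemma continuous01_comp (phi : C -> C) f :
  (forall t, 0 <= t <= 1 -> second_order phi (f t)) ->
  continuous01 f -> continuous01 (fun t => phi (f t)).
Proof.
move=> hphi hf t ht eps eps_gt0.
have [d1 d1_gt0 h1] := second_order_continuous (hphi _ ht) eps_gt0.
have [d d_gt0 h] := hf t ht d1 d1_gt0.
by exists d => // u hu /(h _ hu)/h1; rewrite subrKC.
Qed.

Lemma continuous01D f g :
  continuous01 f -> continuous01 g -> continuous01 (fun t => f t + g t).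
Proof.
move=> hf hg t ht eps eps_gt0; have e2 : 0 < eps / 2 by rewrite divr_gt0.
have [d d_gt0 h] := hf t ht _ e2; have [d' d'_gt0 h'] := hg t ht _ e2.
exists (Num.min d d') => [|u hu]; first by rewrite lt_min d_gt0.
rewrite lt_min => /andP[/(h _ hu) l1 /(h' _ hu) l2].
rewrite opprD addrACA [ltRHS]splitr.
by apply: le_lt_trans (ncD _ _) _; exact: ltrD.
Qed.

(** By polarization, [4 f g = (f + g)^2 - (f - g)^2], products reduce to sums and to compositions
    with squaring and scaling. *)
Lemma continuous01M f g :
  continuous01 f -> continuous01 g -> continuous01 (fun t => f t * g t).
Proof.
move=> hf hg.
have hsq k : continuous01 k -> continuous01 (fun t => k t ^+ 2).
  apply: (@continuous01_comp (fun z => z ^+ 2)) => t _.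
  by apply: second_orderX; exact: second_order_id.
have hmul c k : continuous01 k -> continuous01 (fun t => c * k t).
  apply: (@continuous01_comp (fun z => c * z)) => t _.
  by apply: second_orderM; [exact: second_order_cst | exact: second_order_id].
have -> : (fun t => f t * g t) =
    (fun t => 4^-1 * (f t + g t) ^+ 2 + (- 4^-1) * (f t + (-1) * g t) ^+ 2).
  by apply/funext => t; field.
apply: continuous01D; apply: (hmul); apply: (hsq); apply: continuous01D => //.
exact: hmul.
Qed.

Lemma continuous01_within f : continuous01 f ->
  {within `[0, 1], continuous (f : R -> R[i]^o)}.
Proof.
move=> hf; apply/subspace_continuousP => t; rewrite /= in_itv /= => ht.
apply/cvgrPdist_lt => eps eps_gt0.
have epsE : eps = (Re eps)%:C by rewrite RRe_real// gtr0_real.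
have e_gt0 : 0 < Re eps by rewrite -ltcR -epsE.
have [d d_gt0 h] := hf t ht _ e_gt0.
rewrite near_withinE; apply/nbhs_ballP; exists d => //= u; rewrite /ball /= => hu.
rewrite in_itv /= => u01.
by rewrite epsE normrcE ltcR ncBC h// distrC.
Qed.

Lemma continuous01_Re_within f : continuous01 f ->
  {within `[0, 1], continuous (fun t => Re (f t))}.
Proof.
move=> hf; apply/subspace_continuousP => t; rewrite /= in_itv /= => ht.
apply/cvgrPdist_lt => eps eps_gt0.
have [d d_gt0 h] := hf t ht _ eps_gt0.
rewrite near_withinE; apply/nbhs_ballP; exists d => //= u; rewrite /ball /= => hu.
rewrite in_itv /= => u01.
apply: le_lt_trans (h u u01 _); last by rewrite distrC.
by rewrite ncBC; apply: le_trans (Re_le_nc _); rewrite raddfB.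
Qed.

(** The quotient [s1 / s2] takes only the values [1] and [-1] and starts at [1]; reaching [-1] would
    force its real part through [0]. *)
Lemma continuous01_root_unique s1 s2 : continuous01 s1 -> continuous01 s2 ->
  (forall t, 0 <= t <= 1 -> s1 t ^+ 2 = s2 t ^+ 2 /\ s2 t != 0) ->
  s1 0 = s2 0 -> s1 1 = s2 1.
Proof.
move=> h1 h2 hsq s0.
have s1_ne t : 0 <= t <= 1 -> s2 t != 0 by move=> /hsq[].
pose q t := s1 t * (s2 t)^-1.
have hq : continuous01 q.
  apply: continuous01M => //; apply: (@continuous01_comp (fun z => z^-1)) => // t /s1_ne.
  by apply: second_orderV; exact: second_order_id.
have q_pm t : 0 <= t <= 1 -> q t = 1 \/ q t = -1.
  move=> ht; have [sq ne] := hsq t ht; move/eqP: sq; rewrite eqf_sqr.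
  by move=> /orP[]/eqP E; [left | right]; rewrite /q E ?mulNr divff.
have [i0 i1] : (0 <= (0 : R) <= 1) /\ (0 <= (1 : R) <= 1) by rewrite !lexx ler01.
have q0 : q 0 = 1 by rewrite /q s0 divff ?s1_ne.
have [q1|q1] := q_pm 1 i1.
  by apply: (mulIf (invr_neq0 (s1_ne 1 i1))); rewrite divff ?s1_ne.
have [||t] := @IVT R (fun t => Re (q t)) 0 1 0 ler01.
- exact: continuous01_Re_within.
- by rewrite q0 q1 /= ge_min le_max lerN10 ler01 orbT.
rewrite in_itv /= => /q_pm[->|->] /= /eqP; first by rewrite oner_eq0.
by rewrite oppr_eq0 oner_eq0.
Qed.

(** For a loop avoiding [0], this says that its winding number about [0] is even. *)
Definition has_closed_root f : Prop :=
  exists s, [/\ continuous01 s, forall t, 0 <= t <= 1 -> s t ^+ 2 = f t & s 0 = s 1].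

(** Here [g = f (1 - q)] with [|q| < 1], and the principal root of [1 - q] is continuous; it
    multiplies the root of [f]. The division by [1] below matches [second_order_sqrtc] with
    [zeta = 1]. *)
Lemma has_closed_root_near f g : continuous01 f -> continuous01 g ->
  f 0 = f 1 -> g 0 = g 1 ->
  (forall t, 0 <= t <= 1 -> nc (g t - f t) < nc (f t)) ->
  has_closed_root f -> has_closed_root g.
Proof.
move=> hf hg f01 g01 lt [s [hs s2 s01]].
have f_ne t : 0 <= t <= 1 -> f t != 0.
  by move=> /lt h; rewrite -nc_gt0; apply: le_lt_trans h; exact: nc_ge0.
pose q t := (f t + (-1) * g t) * (f t)^-1.
have q_lt1 t : 0 <= t <= 1 -> nc (q t) < nc (1 : C).
  move=> ht; rewrite ncM ncV nc1 ltr_pdivrMr ?nc_gt0 ?f_ne// mul1r mulN1r ncBC.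
  exact: lt.
have hq : continuous01 q.
  apply: continuous01M.
    by apply: continuous01D => //; apply: continuous01M => //; exact: continuous01_cst.
  apply: (@continuous01_comp (fun z => z^-1)) => // t /f_ne.
  by apply: second_orderV; exact: second_order_id.
exists (fun t => s t * sqrtc (1 - q t / 1)); split.
- apply: continuous01M => //.
  apply: (@continuous01_comp (fun z => sqrtc (1 - z / 1))) => // t /q_lt1.
  exact: second_order_sqrtc.
- move=> t ht; rewrite exprMn s2// sqr_sqrtc divr1 /q.
  by field; rewrite f_ne.
- by rewrite /q s01 f01 g01.
Qed.

(** The constant loop at the end of the homotopy has a closed root, and [has_closed_root_near]
    carries this back to [g - c] in finitely many small steps. By uniqueness up to sign, [s] is
    closed as well. *)
Lemma null_homotopic_root (D : set R[i]^o) (g : R -> R[i]^o) c s :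
  ~ D c -> is_null_homotopic_in D g -> continuous01 s ->
  (forall t, 0 <= t <= 1 -> s t ^+ 2 = g t - c) -> s 0 = s 1.
Proof.
move=> Dc [H [Hcont HD H0 Hends]] hs s2.
pose Sq := (`[0, 1] `*` `[0, 1] : set (R * R)).
have HcontE (x y : R) (eps : R) : 0 <= x <= 1 -> 0 <= y <= 1 -> 0 < eps -> exists2 d : R, 0 < d &
    forall x' y' : R, 0 <= x' <= 1 -> 0 <= y' <= 1 -> `|x' - x| < d -> `|y' - y| < d ->
    nc (H (x', y') - H (x, y)) < eps.
  move=> hx hy eps_gt0.
  have hxy : Sq (x, y) by split; rewrite /= in_itv.
  have /cvgrPdist_lt/(_ eps%:C) := (subspace_continuousP Sq H).1 Hcont _ hxy.
  rewrite ltcR near_withinE => /(_ eps_gt0)/nbhs_ballP[d /= d_gt0 hd].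
  exists d => // x' y' hx' hy' bx b_y.
  have := hd (x', y'); rewrite normrcE ltcR ncBC; apply.
    by split; rewrite /ball /= distrC.
  by split; rewrite /= in_itv.
have H_ne x y : 0 <= x <= 1 -> 0 <= y <= 1 -> 0 < nc (H (x, y) - c).
  move=> hx hy; rewrite nc_gt0 subr_eq0; apply/eqP => E; apply: Dc; rewrite -E.
  by apply: HD; exists (x, y) => //; split; rewrite /= in_itv.
have [d d_gt0 hd] : exists2 d : R, 0 < d & forall x x' y, 0 <= x <= 1 -> 0 <= x' <= 1 ->
    0 <= y <= 1 -> `|x' - x| < d -> nc (H (x', y) - H (x, y)) < nc (H (x, y) - c).
  have cSq : compact Sq by apply: compact_setX; exact: segment_compact.
  have /compact_near_coveringP cov := cSq.
  have [|d [d_gt0 hd]] := @filter_ex _ (0^'+ : set_system R) _ _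
    (filterI (nbhs_right_gt (0 : R)) (cov R (0^'+ : set_system R)
    (fun d p => Sq p -> forall x', 0 <= x' <= 1 -> `|x' - p.1| < d ->
       nc (H (x', p.2) - H p) < nc (H p - c)) _ _)).
    move=> [x0 y0] [/=]; rewrite !in_itv /= => hx0 hy0.
    have m_gt0 := H_ne _ _ hx0 hy0; set m := nc _ in m_gt0.
    (* Two values within [m / 4] of the central one differ by less than [m / 2], while their
       distance to [c] stays above [3 m / 4]. *)
    have [d d_gt0 hd] := HcontE x0 y0 (m / 4) hx0 hy0 (divr_gt0 m_gt0 (ltr0Sn R 3)).
    have d2 : 0 < d / 2 by rewrite divr_gt0.
    exists (ball (x0, y0) (d / 2), [set e | e < d / 2]) => /=.
      by split; [exact: nbhsx_ballx | exact: nbhs_right_lt].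
    move=> [[x y] e] [/= [/= bx b_y] ed] [/=]; rewrite !in_itv /= => hx hy x' hx' x'x.
    rewrite /ball /= in bx b_y.
    have xx0 : `|x - x0| < d by rewrite distrC; lra.
    have yy0 : `|y - y0| < d by rewrite distrC; lra.
    have x'x0 : `|x' - x0| < d.
      have := ler_distD x x' x0; rewrite (distrC x x0); lra.
    have l1 := hd x y hx hy xx0 yy0; have l2 := hd x' y hx' hy x'x0 yy0.
    have := ncB (H (x', y) - H (x0, y0)) (H (x, y) - H (x0, y0)).
    rewrite (_ : _ - _ - _ = H (x', y) - H (x, y)); last by ring.
    move=> l3.
    have := nc_ge_sub (H (x0, y0) - c) (H (x, y) - H (x0, y0)).
    rewrite (_ : _ - _ + _ = H (x, y) - c); last by ring.
    by rewrite -/m; lra.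
  exists d => // x x' y hx hx' hy; exact: (hd (x, y)).
have Hroot x : 0 <= x <= 1 -> continuous01 (fun t => H (x, t) - c) /\
    H (x, 0) - c = H (x, 1) - c.
  move=> hx; split.
    move=> t ht eps eps_gt0; have [e e_gt0 he] := HcontE x t eps hx ht eps_gt0.
    exists e => // u hu ut; rewrite opprB addrA subrK; apply: he => //.
    by rewrite subrr normr0.
  by have [|-> ->] := Hends x; first by rewrite in_itv.
have [N N_gt0 hN] : exists2 N : nat, (0 < N)%N & N%:R^-1 < d.
  exists (Num.truncn d^-1).+1 => //.
  rewrite -[ltRHS]invrK ltf_pV2 ?posrE ?invr_gt0 ?ltr0n//.
  by rewrite truncnS_gt.
have N0 : (0 : R) < N%:R by rewrite ltr0n.
(* The homotopy parameter descends from [1], the constant loop, to [0], the loop [g]. *)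
pose x k : R := (N - k)%:R / N%:R.
have hx k : 0 <= x k <= 1.
  by rewrite divr_ge0//= ler_pdivrMr// mul1r ler_nat leq_subr.
have root k : (k <= N)%N -> has_closed_root (fun t => H (x k, t) - c).
  elim: k => [_|k IH kN].
    exists (fun=> sqrtc (g 0 - c)); split => // [|t ht]; first exact: continuous01_cst.
    by rewrite sqr_sqrtc /x subn0 divff ?lt0r_neq0// (H0 t _).2// in_itv.
  have [c1 e1] := Hroot _ (hx k); have [c2 e2] := Hroot _ (hx k.+1).
  apply: (has_closed_root_near c1 c2 e1 e2) => [t ht|]; last exact/IH/ltnW.
  rewrite opprB addrA subrK; apply: hd => //.
  have -> : x k.+1 - x k = - N%:R^-1.
    rewrite /x -mulrBl !natrB ?(ltnW kN)// -natr1; field.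
    exact: lt0r_neq0.
  by rewrite normrN gtr0_norm ?invr_gt0.
have [s' [hs' s'2 s'01]] := root N (leqnn N).
have x0 : x N = 0 by rewrite /x subnn mul0r.
have s's t : 0 <= t <= 1 -> s' t ^+ 2 = s t ^+ 2 /\ s t != 0.
  move=> ht; have E : s' t ^+ 2 = s t ^+ 2 by rewrite s'2// s2// x0 (H0 t _).1// in_itv.
  split=> //; rewrite -sqrf_eq0 -E s'2// -nc_eq0 lt0r_neq0// H_ne//.
have i0 : 0 <= (0 : R) <= 1 by rewrite lexx ler01.
have /eqP := (s's 0 i0).1; rewrite eqf_sqr => /orP[]/eqP E.
  by rewrite -(continuous01_root_unique hs' hs s's E) -s'01.
have hNs' : continuous01 (fun t => (-1) * s' t).
  by apply: continuous01M => //; exact: continuous01_cst.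
rewrite -(continuous01_root_unique hNs' hs _ _).
- by rewrite -s'01 E mulrN mulN1r opprK.
- by move=> t /s's[<- ?]; rewrite exprMn sqrrN expr1n mul1r.
- by rewrite E mulN1r opprK.
Qed.

End SquareRootAlongLoop.

(** * Multipliers *)

Section Multipliers.
Context {R : realType}.
Local Notation C := R[i].
Implicit Types (z w c mu : C).

(* If [h z = - h w], then the image under [F] of the path from [0] to [z]
   followed by the path from [w] to [0] is a loop in [D] along which the square
   root [h] of [1 - F / c] changes sign. *)
Lemma root_sum_neq0 (D : set R[i]^o) (F h : C -> C) c :
  is_simply_connected R D -> ~ D c -> c != 0 ->
  (forall z, nc z <= 1 -> D (F z)) ->
  (forall z, h z ^+ 2 = 1 - F z / c) -> h 0 = 1 ->
  (forall z, nc z <= 1 -> second_order h z) ->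
  forall z w, nc z <= 1 -> nc w <= 1 -> h z + h w != 0.
Proof.
move=> [_ Dsc] Dc c0 FD h2 h0 hh z w hz hw; apply/eqP => hzw.
pose a (t : R) : R := Num.min 1 (2 * t).
pose b (t : R) : R := Num.min 1 (2 - 2 * t).
have a01 t : 0 <= t <= 1 -> 0 <= a t <= 1.
  by move=> /andP[t0 t1]; rewrite le_min ler01 ge_min lexx mulr_ge0.
have b01 t : 0 <= t <= 1 -> 0 <= b t <= 1.
  by move=> /andP[t0 t1]; rewrite le_min ler01 ge_min lexx !andbT /=; lra.
have seg_cont (e : R -> R) v : nc v <= 1 -> (forall t, 0 <= t <= 1 -> 0 <= e t <= 1) ->
    (forall t u, `|e u - e t| <= 2 * `|u - t|) ->
    continuous01 (fun t => h ((e t)%:C * v)).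
  move=> hv e01 eL; apply: (continuous01_comp (phi := h)) => [t /e01/andP[e0 e1]|t _ eps eps_gt0].
    by apply: hh; rewrite ncM nc_real ger0_norm// -[leRHS]mulr1 ler_pM ?nc_ge0.
  exists (eps / 2) => [|u _ ut]; first by rewrite divr_gt0.
  rewrite -mulrBl -rmorphB ncM nc_real; have := eL t u; have := nc_ge0 v.
  have := normr_ge0 (e u - e t); nra.
(* The factor [k] turns [h^2 = 1 - F / c] into [(k h)^2 = F - c]. *)
pose k := sqrtc (- c).
have k2 : k ^+ 2 = - c by exact: sqr_sqrtc.
have k0 : k != 0 by rewrite -sqrf_eq0 k2 oppr_eq0.
(* One formula for both halves of the loop: as [h w = - h z], it equals [k h (2 t z)] while
   [b t = 1], and [- k h ((2 - 2 t) w)] while [a t = 1]. *)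
pose s (t : R) := k * (h ((a t)%:C * z) + (-1) * h ((b t)%:C * w) + (- h z)).
have hs : continuous01 s.
  apply: continuous01M; first exact: continuous01_cst.
  apply: continuous01D; last exact: continuous01_cst.
  apply: continuous01D; last (apply: continuous01M; first exact: continuous01_cst).
    apply: seg_cont => // t u; rewrite /a /Num.min.
    by case: ltP => ?; case: ltP => ?; rewrite ler_norml;
       have := ler_norm (u - t); have := ler_norm (t - u); rewrite distrC; lra.
  apply: seg_cont => // t u; rewrite /b /Num.min.
  by case: ltP => ?; case: ltP => ?; rewrite ler_norml;
     have := ler_norm (u - t); have := ler_norm (t - u); rewrite distrC; lra.
pose g (t : R) : R[i]^o := s t ^+ 2 + c.
have hwz : h w = - h z by apply/eqP; rewrite -addr_eq0 addrC hzw.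
have kh v : (k * h v) ^+ 2 + c = F v.
  by rewrite exprMn k2 h2; field.
have gD t : 0 <= t <= 1 -> D (g t).
  move=> ht; rewrite /g /s; have /andP[t0 t1] := ht.
  have [le|gt] := leP t 2^-1.
    have -> : b t = 1 by apply/min_idPl; lra.
    rewrite mul1r hwz mulN1r opprK addrK kh; apply: FD.
    by have /andP[x0 x1] := a01 t ht;
      rewrite ncM nc_real ger0_norm// -[leRHS]mulr1 ler_pM ?nc_ge0.
  have -> : a t = 1 by apply/min_idPl; lra.
  rewrite mul1r addrAC subrr add0r mulN1r mulrN sqrrN kh; apply: FD.
  by have /andP[x0 x1] := b01 t ht;
    rewrite ncM nc_real ger0_norm// -[leRHS]mulr1 ler_pM ?nc_ge0.
have a0 : a 0 = 0 by rewrite /a mulr0; apply/min_idPr.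
have b0 : b 0 = 1 by rewrite /b mulr0 subr0; apply/min_idPl; rewrite ler1n.
have a1 : a 1 = 1 by rewrite /a mulr1; apply/min_idPl; rewrite ler1n.
have b1 : b 1 = 0 by rewrite /b mulr1 subrr; apply/min_idPr.
have s0 : s 0 = k by rewrite /s a0 b0 mul0r h0 mul1r hwz; ring.
have s1 : s 1 = - k by rewrite /s a1 b1 mul0r h0 mul1r; ring.
have gpath : is_path_in D g.
  split.
    apply: continuous01_within; apply: continuous01D; last exact: continuous01_cst.
    exact: continuous01M.
  by move=> _ [t + <-]; rewrite /= in_itv /=; exact: gD.
have g01 : g 0 = g 1 by rewrite /g s0 s1 sqrrN.
have := null_homotopic_root Dc (Dsc _ gpath g01) hs _.
rewrite s0 s1 => H; have /eqP : k = - k by apply: H => t _; rewrite /g addrK.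
by rewrite -addr_eq0 -mulr2n mulrn_eq0 (negPf k0).
Qed.

(** Through this reversal, a nonzero root [z] of [z^n - mu p(z)] corresponds to a solution
    [w = 1 / z] of [mu F w = 1], where [F w] is the right-hand side. *)
Lemma horner_averaging_poly (a : seq C) w : w != 0 ->
  w ^+ size a * (averaging_poly a).[w^-1] = w * (Poly a).[w].
Proof.
move=> w0; rewrite /averaging_poly.
rewrite (@horner_coef_wide _ (size a)); last by rewrite (leq_trans (size_Poly _))// size_rev.
rewrite (@horner_coef_wide _ (size a) (Poly a)) ?size_Poly//.
rewrite !mulr_sumr (reindex_inj rev_ord_inj); apply: eq_bigr => i _ /=.
rewrite !coef_Poly nth_rev ?rev_ord_proof//.
have -> : (size a - (size a - i.+1).+1 = i)%N.
  by rewrite subnSK ?subKn// ltnW.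
have -> : w ^+ size a = w ^+ (size a - i.+1) * w ^+ i.+1 by rewrite -exprD subnK.
by rewrite exprS exprVn; field; rewrite expf_neq0.
Qed.

Lemma multiplier_bound (M : set C) (n : nat) (a : n.-tuple C) mu :
  is_simply_connected R (reciprocal_complement M) -> is_averaging_set a ->
  (forall nu, M nu -> stabilizes a nu) -> M mu -> nc mu <= 27 * n%:R ^+ 2.
Proof.
move=> Dsc [sum1 a0] hstab Mmu.
have [->|mu0] := eqVneq mu 0; first by rewrite nc0 mulr_ge0 ?sqr_ge0.
have n_gt0 : (0 < n)%N.
  (* In an empty sequence the entry of index [0] would be the default value [0]. *)
  by rewrite lt0n; apply/eqP => n0; move: a0; rewrite nth_default ?eqxx// size_tuple n0.
pose F : {poly C} := 'X * Poly a.
have FE z : F.[z] = z * (Poly a).[z] by rewrite hornerM hornerX.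
have size_a : (size (Poly a) <= n)%N by rewrite (leq_trans (size_Poly _))// size_tuple.
have F1 : F.[1] = 1.
  rewrite FE mul1r (horner_coef_wide _ size_a) -[RHS]sum1 (big_nth 0).
  rewrite size_tuple big_mkord; apply: eq_bigr => i _.
  by rewrite coef_Poly expr1n mulr1.
(* If [F z = 1 / nu] with [|z| <= 1], then [1 / z] is a root of modulus at least [1], against
   stabilization. The multiplier [nu = 0] has reciprocal [None], which is no value of [F]. *)
have FD z : nc z <= 1 -> reciprocal_complement M F.[z].
  move=> hz [nu Mnu]; rewrite /sphere_inv; case: eqP => // /eqP nu0 [nuF].
  have z0 : z != 0.
    apply/eqP => z0; move/eqP: nuF; rewrite FE z0 mul0r invr_eq0.
    by rewrite (negPf nu0).
  have := hstab nu Mnu z^-1; rewrite /unit_disk /= normrcE ltcR ncV.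
  have zinv : root ('X^(size a) - nu *: averaging_poly a) z^-1.
    rewrite rootE hornerD hornerN hornerZ hornerXn subr_eq0.
    apply/eqP; apply: (mulfI (expf_neq0 (size a) z0)).
    rewrite mulrCA horner_averaging_poly// -FE -nuF divff// -exprMn divff//.
    by rewrite expr1n.
  move=> /(_ zinv); rewrite ltNge => /negP; apply.
  by rewrite -[leLHS]invr1 lef_pV2 ?posrE ?nc_gt0.
pose p : {poly C} := 1 - mu *: F.
have pE z : p.[z] = 1 - F.[z] / mu^-1.
  by rewrite /p hornerD hornerN hornerZ hornerC invrK mulrC.
have Dc : ~ reciprocal_complement M mu^-1.
  by move=> H; apply: H; exists mu => //; rewrite /sphere_inv (negPf mu0).
have p0 : p.[0] = 1 by rewrite pE FE !mul0r subr0.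
have pne z : nc z <= 1 -> p.[z] != 0.
  move=> /FD DF; rewrite pE subr_eq0; apply/eqP => E; apply: Dc.
  suff <- : F.[z] = mu^-1 by [].
  by apply: (mulIf mu0); rewrite mulVf// E invrK.
have [h [h0 h2 hh]] := exists_sqrt p0 pne.
have hne := root_sum_neq0 Dsc Dc (invr_neq0 mu0) FD
  (fun z => etrans (h2 z) (pE z)) h0 hh.
have hdist b : nc b < 1 -> _ := gelfer_distortion hh (fun z _ => h2 z) hne.
(* With this radius [(1 + r) / (1 - r) = n + 1], and [r^-n] is the power estimated in
   [expn_bound]. *)
pose r : R := n%:R / (n%:R + 2).
have m1 : (1 : R) <= n%:R by rewrite ler1n.
have r01 : 0 < r < 1.
  by rewrite /r divr_gt0 ?ltr_pdivrMr//; lra.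
have sF : (size (mu *: F) <= n.+1)%N.
  apply: leq_trans (size_scale_leq _ _) _; rewrite /F.
  apply: leq_trans (size_polyMleq _ _) _; rewrite size_polyX /=.
  by rewrite ltnS.
have hK w : nc w = r -> nc (mu *: F).[w] <= 1 + (n%:R + 1) ^+ 2.
  move=> wr; have -> : (mu *: F).[w] = 1 - p.[w] by rewrite /p !hornerE; ring.
  apply: le_trans (ncB _ _) _; rewrite nc1 lerD2l.
  have /andP[_ r1] := r01.
  have := growth_bound hdist p0 (z := w); rewrite wr => /(_ r1).
  suff -> : (1 + r) / (1 - r) = n%:R + 1 by [].
  by rewrite /r; field; rewrite !lt0r_neq0//; lra.
have := poly_growth_le sF r01 hK.
rewrite hornerZ F1 mulr1 => le; apply: le_trans (expn_bound n_gt0).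
have r_gt0 : 0 < r by case/andP: r01.
have -> : (n%:R + 2) / n%:R = r^-1 by rewrite /r invf_div.
by rewrite exprVn ler_pdivlMr ?exprn_gt0// mulrC.
Qed.

End Multipliers.

Theorem theorem5 (R : realType) (M : set R[i]) (n : nat) (a : n.-tuple R[i]) :
  is_domain (reciprocal_complement M) ->
  is_simply_connected R (reciprocal_complement M) ->
  reciprocal_complement M 0 ->
  reciprocal_complement M <> setT ->
  is_averaging_set a ->
  (forall mu : R[i], M mu -> stabilizes a mu) ->
  (n%:R%:E >= sqrte (sup_norm M) / (3 * Num.sqrt 3)%:E)%E.
Proof.
move=> _ Dsc _ _ ha hstab.
have s3 : 0 < 3 * Num.sqrt 3 :> R by rewrite mulr_gt0// sqrtr_gt0.
have sup_le : (sup_norm M <= (27 * n%:R ^+ 2 : R)%:E)%E.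
  apply: ge_ereal_sup => _ [mu Mmu <-].
  by rewrite lee_fin; exact: multiplier_bound Dsc ha hstab Mmu.
rewrite inver (gt_eqF s3) lee_pdivrMr// -EFinM.
(* As [27 = (3 sqrt 3)^2], the claim is the square root of the bound on the supremum. *)
have -> : (n%:R * (3 * Num.sqrt 3))%:E = sqrte (27 * n%:R ^+ 2 : R)%:E.
  rewrite /=; congr (_%:E).
  have -> : 27 * n%:R ^+ 2 = (3 * n%:R) ^+ 2 * 3 :> R by ring.
  rewrite sqrtrM ?sqr_ge0// sqrtr_sqr ger0_norm ?mulr_ge0//; ring.
by rewrite lee_sqrt// lee_fin mulr_ge0 ?sqr_ge0.
Qed.
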